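(* If $U_1\in O_\epsilon(U_b)$ and $U_2,U_3\in O_\epsilon(U_{m1})$ with $$\{U_1,U_2\}=(\sigma_1,\alpha_2,\alpha_3,\alpha_4),\qquad \{U_2,U_3\}=(\beta_1,\beta_2,\beta_3,0),$$ then there exists a unique $(\sigma_1',\delta_2,\delta_3,\delta_4)$ such that $\{U_1,U_3\}=(\sigma_1',\delta_2,\delta_3,\delta_4)$. Moreover, $$\sigma_1'=\sigma_1+K_{1sa1}\beta_1+O(1)\Delta'',\qquad \delta_2=\alpha_2+\beta_2+K_{1sa2}\beta_1+O(1)\Delta'',$$ $$\delta_3=\alpha_3+\beta_3+K_{1sa3}\beta_1+O(1)\Delta'',\qquad \delta_4=\alpha_4+K_{1sa4}\beta_1+O(1)\Delta'',$$ with $$\Delta''=|\alpha_4|(|\beta_1|+|\beta_2|+|\beta_3|),\qquad |K_{1sa4}|<1,\qquad \sum_{j=1}^3|K_{1saj}|\le M.$$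
   Context: Fix $\gamma>1$. For $U=(u,v,p,\rho)$ with $p,\rho>0$ put $c=\sqrt{\gamma p/\rho}$, $h=\frac{\gamma p}{(\gamma-1)\rho}$, $$W(U)=\big(\rho u,\rho u^2+p,\rho uv,\rho u(h+\tfrac{u^2+v^2}{2})\big),\quad H(U)=\big(\rho v,\rho uv,\rho v^2+p,\rho v(h+\tfrac{u^2+v^2}{2})\big).$$ The steady full Euler system is $W(U)_x+H(U)_y=0$. For $u>c$ its eigenvalues are $\lambda_j=\frac{uv+(-1)^jc\sqrt{u^2+v^2-c^2}}{u^2-c^2}$ ($j=1,4$), $\lambda_2=\lambda_3=v/u$, with eigenvectors $\mathbf r_j=\kappa_j(-\lambda_j,1,\rho(\lambda_ju-v),\rho(\lambda_ju-v)/c^2)^\top$ ($j=1,4$, $\kappa_j$ chosen so that $\mathbf r_j\cdot\nabla\lambda_j=1$), $\mathbf r_2=(u,v,0,0)^\top$, $\mathbf r_3=(0,0,0,\rho)^\top$. Shocks. A $j$-shock ($j=1,4$) of slope (speed) $s$ between $U_-$ (below) and $U_+$ (above) satisfies $s(W(U_+)-W(U_-))=H(U_+)-H(U_-)$ and the entropy conditions $\lambda_j(U_+)<s<\lambda_j(U_-)$, with $s<\lambda_2(U_-)$ if $j=1$ and $\lambda_2(U_+)<s$ if $j=4$. Elementary waves. For $j=1,4$, $\alpha\mapsto\Phi_j(\alpha;U)$ is a fixed (Lax) $C^2$ parametrization of the states that lie above a state $U$ and are connected to it by a $j$-rarefaction wave ($\alpha>0$) or a $j$-shock ($\alpha<0$),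 with $\Phi_j(0;U)=U$, $\partial_\alpha\Phi_j(0;U)=\mathbf r_j(U)$; $\Phi_2(\alpha;U)=(ue^\alpha,ve^\alpha,p,\rho)$, $\Phi_3(\alpha;U)=(u,v,p,\rho e^\alpha)$; $\Phi(\alpha_4,\alpha_3,\alpha_2,\alpha_1;U)=\Phi_4(\alpha_4;\Phi_3(\alpha_3;\Phi_2(\alpha_2;\Phi_1(\alpha_1;U))))$. Background states. $U_b=(u_b,v_b,p_b,\rho_b)$ and $U_{m1}=(u_{m1},0,p_{m1},\rho_{m1})$ are fixed, both with $u>c$, and connected ($U_b$ below, $U_{m1}$ above) by a strong $1$-shock of speed $\sigma_{10}$. For $U$ near $U_b$ and $\sigma_1$ near $\sigma_{10}$, $G_1(\sigma_1;U)$ denotes the unique state near $U_{m1}$ connected to $U$ from above by a $1$-shock of speed $\sigma_1$, so $G_1(\sigma_{10};U_b)=U_{m1}$. Notation. For two states near the same background state, $\{U,V\}=(\alpha_1,\alpha_2,\alpha_3,\alpha_4)$ means $V=\Phi(\alpha_4,\alpha_3,\alpha_2,\alpha_1;U)$ with small $\alpha_i$. For $U$ near $U_b$ and $V$ near $U_{m1}$, $\{U,V\}=(\sigma_1,\alpha_2,\alpha_3,\alpha_4)$ means $V=\Phi(\alpha_4,\alpha_3,\alpha_2,0;G_1(\sigma_1;U))$ with $\sigma_1$ near $\sigma_{10}$ and small $\alpha_i$. $O_\epsilon(\cdot)$ denotes sufficiently small neighborhoods, $M>0$ a large constant, both depending only on the system and the background states; $O(1)$ denotes a quantity bounded in absolute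 value by $M$; uniqueness is within these parameter neighborhoods. The coefficients $K$ may depend on the given states and wave strengths. *)

(* Defs.v *)
From mathcomp Require Import all_boot all_order all_algebra.
From mathcomp Require Import all_classical all_reals all_analysis.
Set Implicit Arguments.
Unset Strict Implicit.
Unset Printing Implicit Defensive.
Import Order.TTheory GRing.Theory Num.Theory numFieldNormedType.Exports.
Local Open Scope classical_set_scope.
Local Open Scope ring_scope.

Section SteadyEuler.
Context {R : realType}.
Implicit Types (U V : 'rV[R]_4) (s : R) (j : nat).

Definition vec4 (a b c d : R) : 'rV[R]_4 := \row_(i < 4) [:: a; b; c; d]`_i.

(* Components of U = (u, v, p, rho). *)
Definition velu U : R := U 0 (inord 0).
Definition velv U : R := U 0 (inord 1).
Definition pres U : R := U 0 (inord 2).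
Definition dens U : R := U 0 (inord 3).

(* Continuous differentiability on an open set of a finite-dimensional space,
   expressed with directional derivatives. *)
Definition C1_on (E F : normedModType R) (A : set E) (f : E -> F) : Prop :=
  forall e x, A x -> derivable f x e /\ {for x, continuous ('D_e f)}.

Definition C2_on (E F : normedModType R) (A : set E) (f : E -> F) : Prop :=
  C1_on A f /\ forall e, C1_on A ('D_e f).

Section Gas.
Variable gamma : R.

Definition sound U : R := Num.sqrt (gamma * pres U / dens U).
Definition enthalpy U : R := gamma * pres U / ((gamma - 1) * dens U).

Definition flux_W U : 'rV[R]_4 :=
  let: (u, v, p, rho) := (velu U, velv U, pres U, dens U) in
  vec4 (rho * u) (rho * u ^+ 2 + p) (rho * u * v)
       (rho * u * (enthalpy U + (u ^+ 2 + v ^+ 2) / 2)).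

Definition flux_H U : 'rV[R]_4 :=
  let: (u, v, p, rho) := (velu U, velv U, pres U, dens U) in
  vec4 (rho * v) (rho * u * v) (rho * v ^+ 2 + p)
       (rho * v * (enthalpy U + (u ^+ 2 + v ^+ 2) / 2)).

Definition supersonic U : Prop :=
  [/\ 0 < pres U, 0 < dens U & sound U < velu U].

(* Meant for j = 1 and j = 4 only, like [eigvec] and the notions below. *)
Definition lambda j U : R :=
  let: (u, v, c) := (velu U, velv U, sound U) in
  (u * v + (- 1) ^+ j * c * Num.sqrt (u ^+ 2 + v ^+ 2 - c ^+ 2))
    / (u ^+ 2 - c ^+ 2).

Definition lambda2 U : R := velv U / velu U.

Definition raw_eigvec j U : 'rV[R]_4 :=
  let: (u, v, c, rho, l) := (velu U, velv U, sound U, dens U, lambda j U) in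
  vec4 (- l) 1 (rho * (l * u - v)) (rho * (l * u - v) / c ^+ 2).

Definition grad (f : 'rV[R]_4 -> R) U : 'rV[R]_4 :=
  \row_(i < 4) 'D_(delta_mx 0 i) (f : 'rV[R]_4 -> R^o) U.

Definition kappa j U : R :=
  (\sum_(i < 4) raw_eigvec j U 0 i * grad (lambda j) U 0 i)^-1.

Definition eigvec j U : 'rV[R]_4 := kappa j U *: raw_eigvec j U.

(* j-shock of slope s, with U below and V above. *)
Definition shock j s U V : Prop :=
  [/\ supersonic U /\ supersonic V,
      s *: (flux_W V - flux_W U) = flux_H V - flux_H U,
      lambda j V < s < lambda j U,
      j = 1%N -> s < lambda2 U
    & j = 4%N -> lambda2 V < s].

(* j-rarefaction with U below and V above: V is reached from U along an integral
   curve of the j-th field.  Since the derivative of lambda_j along [eigvec j]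
   is 1, T > 0 says that lambda_j increases from U to V. *)
Definition rarefaction j U V : Prop :=
  exists (T : R) (w : R -> 'rV[R]_4),
    [/\ 0 < T, w 0 = U, w T = V
      & forall t : R, 0 <= t <= T ->
          supersonic (w t) /\ is_derive (t : R^o) 1 w (eigvec j (w t))].

(* The last two clauses of the inner conjunction say that, locally, every state
   reached by a j-rarefaction or a j-shock is attained. *)
Definition lax_parametrization j (Phij : R -> 'rV[R]_4 -> 'rV[R]_4) : Prop :=
  forall Ubar, supersonic Ubar -> exists a r : R,
    [/\ 0 < a, 0 < r,
        C2_on [set x : (R^o * 'rV[R]_4)%type | `|x.1| < a /\ ball Ubar r x.2]
              (fun x => Phij x.1 x.2)
      & forall U, ball Ubar r U ->
        [/\ Phij 0 U = U,
            is_derive (0 : R^o) 1 (Phij^~ U) (eigvec j U),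
            (forall t, 0 < t < a -> rarefaction j U (Phij t U)) /\
            (forall t, - a < t < 0 -> exists s, shock j s U (Phij t U)),
            forall V, ball Ubar r V -> rarefaction j U V ->
              exists2 t, 0 < t < a & V = Phij t U
          & forall V s, ball Ubar r V -> shock j s U V ->
              exists2 t, - a < t < 0 & V = Phij t U]].

End Gas.

Definition Phi2 (t : R) U : 'rV[R]_4 :=
  vec4 (velu U * expR t) (velv U * expR t) (pres U) (dens U).

Definition Phi3 (t : R) U : 'rV[R]_4 :=
  vec4 (velu U) (velv U) (pres U) (dens U * expR t).

Definition Phi (Phi1 Phi4 : R -> 'rV[R]_4 -> 'rV[R]_4) (t4 t3 t2 t1 : R) U :=
  Phi4 t4 (Phi3 t3 (Phi2 t2 (Phi1 t1 U))).

(* V = G_1(s; U): V is the unique state within eta of Um1 that is connected to U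
   from above by a 1-shock of slope s. *)
Definition is_G1 (gamma : R) (Um1 : 'rV[R]_4) (eta s : R) U V : Prop :=
  unique (fun V' => ball Um1 eta V' /\ shock gamma 1%N s U V') V.

(* {U, V} = (t1, t2, t3, t4) for two states near the same background state,
   with all strengths smaller than eta. *)
Definition weak_waves (Phi1 Phi4 : R -> 'rV[R]_4 -> 'rV[R]_4) (eta : R) U V
    (t : R * R * R * R) : Prop :=
  let: (t1, t2, t3, t4) := t in
  [/\ `|t1| < eta, `|t2| < eta, `|t3| < eta, `|t4| < eta
    & V = Phi Phi1 Phi4 t4 t3 t2 t1 U].

(* {U, V} = (s, t2, t3, t4) for U near U_b and V near U_m1, with s within eta
   of sigma10 and the strengths smaller than eta. *)
Definition strong_waves (gamma : R) (Phi1 Phi4 : R -> 'rV[R]_4 -> 'rV[R]_4)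
    (Um1 : 'rV[R]_4) (sigma10 eta : R) U V (t : R * R * R * R) : Prop :=
  let: (s, t2, t3, t4) := t in
  [/\ `|s - sigma10| < eta, `|t2| < eta, `|t3| < eta, `|t4| < eta
    & exists2 G, is_G1 gamma Um1 eta s U G & V = Phi Phi1 Phi4 t4 t3 t2 0 G].

End SteadyEuler.

(* Main.v *)
(* For a shock of slope [s] the Rankine-Hugoniot relations can be solved
   explicitly, so the state [G_1(s; U)] is a rational function [shock_state s U].
   At a horizontal supersonic downstream state its [v]-component increases and its
   pressure decreases with [s]; by the symmetry of the 1- and 4-eigenvectors there,
   these opposite signs say exactly that a weak 1-wave hitting the strong shock is
   reflected into a 4-wave with coefficient of absolute value less than 1.

   The state above a strong shock followed by weak waves is a strictly
   differentiable function [F] of the wave strengths [z] with invertible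
   derivative, so Banach's fixed point theorem gives existence, uniqueness and
   Lipschitz dependence of the outgoing strengths.  When [alpha4 = 0] the outgoing
   strengths are [(sigma1, alpha2 + beta2, alpha3 + beta3, 0) + K * beta1] exactly;
   restoring [alpha4] costs a mixed second difference, which is
   [O(|alpha4| |beta|)] because the Lax curves are [C^2]. *)
Require Import Defs.
From HB Require Import structures.
From mathcomp Require Import all_boot all_order all_algebra.
From mathcomp Require Import all_classical all_reals all_analysis.
From mathcomp Require Import ring lra.
Set Implicit Arguments.
Unset Strict Implicit.
Unset Printing Implicit Defensive.
Import Order.TTheory GRing.Theory Num.Theory numFieldNormedType.Exports.
Local Open Scope classical_set_scope.
Local Open Scope ring_scope.

(** * Bounded linear maps between normed spaces *)

Section BoundedLinear.
Context {R : realType}.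
Implicit Types E F G : normedModType R.

(** Strict differentiability is the working notion because it compares two arbitrary points near the
    base point: it is stable under composition, yields Lipschitz constants, and makes the
    contraction argument run on the derivative at a single point. The vector [K] is a difference
    quotient in [beta1], not a derivative. It therefore depends on the data and absorbs every
    interaction that is left when [alpha4 = 0]. The bound on its last component survives because the
    quotient is close to the linearized reflection coefficient, whose distance to 1 is a fixed
    margin. The 2- and 3-waves produce no error of their own because they act by rescaling (u, v)
    and the density: where no 1-wave and no 4-wave separates them, their strengths add exactly. At a
    horizontal state the 2- and 3-waves move only [velu] and [dens], so the reflection is decided by
    the remaining two components, [velv] and [pres]. This is why the signs of just these two shock
    derivatives are computed. *)

Definition blin E F (L : E -> F) : Prop :=
  (forall a u v, L (a *: u + v) = a *: L u + L v) /\
  exists2 k : R, 0 <= k & forall h, `|L h| <= k * `|h|.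

Section Theory.
Context {E F : normedModType R} {L : E -> F}.
Hypothesis Lb : blin L.

Lemma blin0 : L 0 = 0.
Proof.
have := Lb.1 (-1) 0 0; rewrite scaler0 addr0 => h.
by rewrite h scaleN1r addNr.
Qed.

Lemma blinD u v : L (u + v) = L u + L v.
Proof. by have := Lb.1 1 u v; rewrite !scale1r. Qed.

Lemma blinZ a u : L (a *: u) = a *: L u.
Proof. by have := Lb.1 a u 0; rewrite !addr0 blin0 addr0. Qed.

Lemma blinN u : L (- u) = - L u.
Proof. by rewrite -scaleN1r blinZ scaleN1r. Qed.

Lemma blinB u v : L (u - v) = L u - L v.
Proof. by rewrite blinD blinN. Qed.

Lemma blin_sum (I : Type) (r : seq I) (P : pred I) (f : I -> E) :
  L (\sum_(i <- r | P i) f i) = \sum_(i <- r | P i) L (f i).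
Proof. exact: (big_morph L blinD blin0). Qed.

End Theory.

Lemma blin_comp E F G (L : E -> F) (L' : F -> G) :
  blin L -> blin L' -> blin (fun h => L' (L h)).
Proof.
move=> Lb L'b; split=> [a u v|].
  by rewrite (blinD Lb) (blinD L'b) (blinZ Lb) (blinZ L'b).
have [_ [k k0 Lk]] := Lb; have [_ [k' k'0 L'k]] := L'b.
exists (k' * k); first exact: mulr_ge0.
by move=> h; rewrite (le_trans (L'k _))// -mulrA ler_wpM2l.
Qed.

Lemma blin_id E : blin (fun h : E => h).
Proof. by split=> //; exists 1 => // h; rewrite mul1r. Qed.

Lemma blin_cst0 E F : blin (fun _ : E => 0 : F).
Proof.
by split=> [a u v|]; [rewrite scaler0 addr0|exists 0 => // h; rewrite normr0 mul0r].
Qed.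

Lemma blin_fst E F : blin (fun p : E * F => p.1).
Proof.
split=> //; exists 1 => // -[u v] /=; rewrite mul1r prod_normE /=.
by rewrite le_max lexx.
Qed.

Lemma blin_snd E F : blin (fun p : E * F => p.2).
Proof.
split=> //; exists 1 => // -[u v] /=; rewrite mul1r prod_normE /=.
by rewrite le_max lexx orbT.
Qed.

Lemma blin_pair E F G (L : E -> F) (L' : E -> G) :
  blin L -> blin L' -> blin (fun h => (L h, L' h)).
Proof.
move=> [La [k k0 Lk]] [L'a [k' k'0 L'k]]; split=> [a u v|].
  by rewrite La L'a.
exists (Num.max k k') => [|h]; first by rewrite le_max k0.
rewrite prod_normE /= ge_max; apply/andP; split.
  by rewrite (le_trans (Lk h))// ler_wpM2r// le_max lexx.
by rewrite (le_trans (L'k h))// ler_wpM2r// le_max lexx orbT.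
Qed.

Lemma blinDf E F (L L' : E -> F) : blin L -> blin L' -> blin (fun h => L h + L' h).
Proof.
move=> [La [k k0 Lk]] [L'a [k' k'0 L'k]]; split=> [a u v|].
  by rewrite La L'a scalerDr addrACA.
exists (k + k') => [|h]; first exact: addr_ge0.
by rewrite (le_trans (ler_normD _ _))// mulrDl lerD.
Qed.

Lemma blinZf E F (a : R) (L : E -> F) : blin L -> blin (fun h => a *: L h).
Proof.
move=> [La [k k0 Lk]]; split=> [b u v|].
  by rewrite La scalerDr !scalerA mulrC.
exists (`|a| * k) => [|h]; first exact: mulr_ge0.
by rewrite normrZ -mulrA ler_wpM2l.
Qed.

Lemma blin_scaler E F (w : F) (L : E -> R^o) : blin L -> blin (fun h => L h *: w).
Proof.
move=> [La [k k0 Lk]]; split=> [b u v|].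
  by rewrite La scalerDl scalerA.
exists (k * `|w|) => [|h]; first exact: mulr_ge0.
by rewrite normrZ mulrAC ler_wpM2r.
Qed.

Lemma blin_sumf E F n (L : nat -> E -> F) :
  (forall i, blin (L i)) -> blin (fun h => \sum_(i < n) L i h).
Proof.
move=> Lb; elim: n => [|n ih].
  rewrite [X in blin X](_ : _ = (fun=> 0)); first exact: blin_cst0.
  by apply/funext => h; rewrite big_ord0.
rewrite [X in blin X](_ : _ = (fun h => \sum_(i < n) L i h + L n h)).
  exact: blinDf.
by apply/funext => h; rewrite big_ord_recr.
Qed.

Lemma mx_norm_coord n (v : 'rV[R]_n) i : `|v 0 i| <= `|v|.
Proof.
rewrite [leRHS]/Num.Def.normr /= mx_normrE.
by apply/bigmax_geP; right; exists (0, i).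
Qed.

Lemma mx_norm_le n (v : 'rV[R]_n) (e : R) :
  0 <= e -> (forall i, `|v 0 i| <= e) -> `|v| <= e.
Proof.
move=> e0 ve; rewrite [leLHS]/Num.Def.normr /= mx_normrE.
by apply: bigmax_le => // -[i j] _ /=; rewrite (ord1 i).
Qed.

Lemma blin_coord n (i : 'I_n) : blin (fun v : 'rV[R]_n => v 0 i : R^o).
Proof.
split=> [a u v|]; first by rewrite !mxE.
by exists 1 => // h; rewrite mul1r mx_norm_coord.
Qed.

Lemma blin_row E n (L : E -> 'rV[R]_n) :
  (forall i, blin (fun h => L h 0 i : R^o)) -> blin L.
Proof.
move=> Lb; split=> [a u v|].
  by apply/rowP => i; rewrite (Lb i).1 !mxE.
pose k i := sval (cid2 (Lb i).2).
have k0 i : 0 <= k i by rewrite /k; case: cid2.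
have Lk i h : `|L h 0 i| <= k i * `|h| by rewrite /k; case: cid2.
exists (\sum_i k i) => [|h]; first exact: sumr_ge0.
apply: mx_norm_le => [|i]; first by rewrite mulr_ge0 // sumr_ge0.
rewrite (le_trans (Lk i h)) // ler_wpM2r // (bigD1 i) //= lerDl.
exact: sumr_ge0.
Qed.

End BoundedLinear.

(** * Strict differentiability at a point *)

Section StrictDiff.
Context {R : realType}.
Implicit Types E F G : normedModType R.

(** Both points [y] and [z] are free, instead of one being [x]: this is what bounds [f y - f z] on
    both sides by [y - z] when [L] is invertible. *)
Definition strict_diff E F (f : E -> F) (x : E) (L : E -> F) : Prop :=
  blin L /\ forall e : R, 0 < e -> exists2 d : R, 0 < d &
    forall y z, `|y - x| < d -> `|z - x| < d ->
      `|f y - f z - L (y - z)| <= e * `|y - z|.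

Lemma strict_diff_eq E F (f g : E -> F) x L L' :
  strict_diff f x L -> f =1 g -> L =1 L' -> strict_diff g x L'.
Proof. by move=> fL /funext <- /funext <-. Qed.

Lemma strict_diff_lip E F (f : E -> F) x L : strict_diff f x L ->
  exists2 k : R, 0 < k & exists2 d : R, 0 < d &
    forall y z, `|y - x| < d -> `|z - x| < d -> `|f y - f z| <= k * `|y - z|.
Proof.
move=> [[_ [k k0 Lk]] /(_ 1 ltr01)[d d0 fd]].
exists (1 + k); first by rewrite ltr_wpDr.
exists d => // y z yd zd.
rewrite -(subrK (L (y - z)) (f y - f z)) (le_trans (ler_normD _ _)) // mulrDl.
by rewrite lerD // fd.
Qed.

Lemma strict_diff_near E F (f : E -> F) x L (e : R) : strict_diff f x L -> 0 < e ->
  exists2 d : R, 0 < d & forall y, `|y - x| < d -> `|f y - f x| < e.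
Proof.
move=> /strict_diff_lip[k k0 [d d0 fk]] e0.
exists (Num.min d (e / k)) => [|y]; first by rewrite lt_min d0 divr_gt0.
rewrite lt_min => /andP[yd ye].
rewrite (le_lt_trans (fk _ _ yd _)) ?subrr ?normr0 //.
by rewrite -ltr_pdivlMl // mulrC.
Qed.

Lemma strict_diff_blin E F (L : E -> F) x : blin L -> strict_diff L x L.
Proof.
move=> Lb; split=> // e e0; exists 1 => // y z _ _.
by rewrite (blinB Lb) subrr normr0 mulr_ge0 // ltW.
Qed.

Lemma strict_diff_cst E F (c : F) (x : E) : strict_diff (fun=> c) x (fun=> 0).
Proof.
split=> [|e e0]; first exact: blin_cst0.
by exists 1 => // y z _ _; rewrite !subrr normr0 mulr_ge0 // ltW.
Qed.

Lemma strict_diff_comp E F G (f : E -> F) (g : F -> G) x y L L' :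
  f x = y -> strict_diff f x L -> strict_diff g y L' ->
  strict_diff (fun z => g (f z)) x (fun h => L' (L h)).
Proof.
move=> <- fL gL; split=> [|e e0]; first exact: blin_comp fL.1 gL.1.
have [k k0 [d1 d10 fk]] := strict_diff_lip fL.
have [[L'a [k' k'0 L'k]] gd] := gL.
(* Half of the error comes from [g], magnified by the Lipschitz constant [k] of [f], and half from
   [f], magnified by the bound [k'] of [L']; [1 + k'] allows for [k' = 0]. *)
have e1 : 0 < e / (2 * k) by rewrite divr_gt0 // mulr_gt0.
have e2 : 0 < e / (2 * (1 + k')).
  by rewrite divr_gt0 // mulr_gt0 // ltr_pwDl.
have [d2 d20 gd2] := gd _ e1.
have [d3 d30 fd3] := fL.2 _ e2.
have [d4 d40 fd4] := strict_diff_near fL d20.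
exists (Num.min d1 (Num.min d3 d4)); first by rewrite !lt_min d10 d30 d40.
move=> u v; rewrite !lt_min => /and3P[u1 u3 u4] /and3P[v1 v3 v4].
have -> : g (f u) - g (f v) - L' (L (u - v)) =
   (g (f u) - g (f v) - L' (f u - f v)) + L' (f u - f v - L (u - v)).
  by rewrite [L' (f u - f v - _)](blinB gL.1) addrA subrK.
rewrite (le_trans (ler_normD _ _)) // (splitr e) mulrDl lerD //.
  rewrite (le_trans (gd2 _ _ (fd4 _ u4) (fd4 _ v4))) //.
  rewrite (le_trans (ler_wpM2l (ltW e1) (fk _ _ u1 v1))) //.
  rewrite mulrA ler_wpM2r // invfM !mulrA mulfVK ?gt_eqF //.
rewrite (le_trans (L'k _)) // (le_trans (ler_wpM2l k'0 (fd3 _ _ u3 v3))) //.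
rewrite mulrA ler_wpM2r // mulrA ler_pdivrMr ?mulr_gt0 ?ltr_pwDl //.
by rewrite mulrA mulfVK // mulrDr mulr1 mulrC lerDr ltW.
Qed.

Lemma strict_diff_pair E F G (f : E -> F) (g : E -> G) x L L' :
  strict_diff f x L -> strict_diff g x L' ->
  strict_diff (fun z => (f z, g z)) x (fun h => (L h, L' h)).
Proof.
move=> [Lb fL] [L'b gL]; split=> [|e e0]; first exact: blin_pair.
have [d1 d10 fd1] := fL _ e0; have [d2 d20 gd2] := gL _ e0.
exists (Num.min d1 d2); first by rewrite lt_min d10.
move=> y z; rewrite !lt_min => /andP[y1 y2] /andP[z1 z2].
by rewrite prod_normE /= ge_max fd1 // gd2.
Qed.

Lemma strict_diffD E F (f g : E -> F) x L L' :
  strict_diff f x L -> strict_diff g x L' ->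
  strict_diff (fun z => f z + g z) x (fun h => L h + L' h).
Proof.
move=> fL gL; have h := strict_diff_pair fL gL.
apply: (strict_diff_comp (g := fun p : F * F => p.1 + p.2)
  (L' := fun p : F * F => p.1 + p.2) erefl h).
exact: (strict_diff_blin _ (blinDf (blin_fst F F) (blin_snd F F))).
Qed.

Lemma strict_diffN E F (f : E -> F) x L :
  strict_diff f x L -> strict_diff (fun z => - f z) x (fun h => - L h).
Proof.
move=> fL; apply: (strict_diff_comp (g := fun p : F => - p)
  (L' := fun p : F => - p) erefl fL).
apply: strict_diff_blin.
rewrite (_ : (fun p : F => - p) = (fun p => (-1) *: p)).
  exact/blinZf/blin_id.
by apply/funext => p; rewrite scaleN1r.
Qed.

Lemma strict_diffB E F (f g : E -> F) x L L' :
  strict_diff f x L -> strict_diff g x L' ->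
  strict_diff (fun z => f z - g z) x (fun h => L h - L' h).
Proof. by move=> fL gL; apply: strict_diffD => //; exact: strict_diffN. Qed.

Lemma strict_diffM E (f g : E -> R^o) x L L' :
  strict_diff f x L -> strict_diff g x L' ->
  strict_diff (fun z => f z * g z : R^o) x (fun h => f x * L' h + g x * L h).
Proof.
move=> fL gL; have h := strict_diff_pair fL gL.
apply: (strict_diff_comp (g := fun p : R^o * R^o => p.1 * p.2 : R^o)
  (L' := fun h : R^o * R^o => f x * h.2 + g x * h.1 : R^o) erefl h).
split=> [|e e0].
  by apply: (@blinDf _ _ R^o); apply: (@blinZf _ _ R^o);
    [exact: blin_snd|exact: blin_fst].
exists (e / 2) => [|[a b] [c d]]; first by rewrite divr_gt0.
rewrite !prod_normE /= !gt_max => /andP[a1 b1] /andP[c1 d1].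
have -> : a * b - c * d - (f x * (b - d) + g x * (a - c)) =
   (a - f x) * (b - d) + (d - g x) * (a - c) :> R by ring.
rewrite (le_trans (ler_normD _ _)) // (splitr e) [leRHS]mulrDl.
rewrite !normrM; apply: lerD; apply: ler_pM => //; first exact: ltW.
- by rewrite le_max lexx orbT.
- exact: ltW.
- by rewrite le_max lexx.
Qed.

Lemma strict_diff_row E n (f : E -> 'rV[R]_n) x (L : E -> 'rV[R]_n) :
  (forall i, strict_diff (fun z => f z 0 i : R^o) x (fun h => L h 0 i)) ->
  strict_diff f x L.
Proof.
move=> fL; split=> [|e e0]; first by apply: blin_row => i; exact: (fL i).1.
pose d i := sval (cid2 ((fL i).2 e e0)).
have dP i : 0 < d i /\ forall y z, `|y - x| < d i -> `|z - x| < d i ->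
    `|f y 0 i - f z 0 i - L (y - z) 0 i| <= e * `|y - z|.
  by rewrite /d; case: cid2.
exists (\big[Num.min/1]_i d i).
  by apply: lt_bigmin => // i _; exact: (dP i).1.
move=> y z yd zd; apply: mx_norm_le => [|i]; first by rewrite mulr_ge0 // ltW.
rewrite !mxE; apply: (dP i).2.
  by rewrite (lt_le_trans yd) // bigmin_le_cond.
by rewrite (lt_le_trans zd) // bigmin_le_cond.
Qed.

Lemma strict_diff_is_derive E F (f : E -> F) x L v :
  strict_diff f x L -> is_derive x v f (L v).
Proof.
move=> fL.
have h : h^-1 *: ((f \o shift x) (h *: v) - f x) @[h --> 0^'] --> L v.
  apply/cvgrPdist_le => e e0.
  have e1 : 0 < e / (1 + `|v|) by rewrite divr_gt0 // ltr_pwDl.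
  have [d d0 fd] := fL.2 _ e1.
  near=> h.
  have h0 : h != 0 by near: h; exact: nbhs_dnbhs_neq.
  have hd : `|h * (1 + `|v|)| < d.
    rewrite normrM (ger0_norm (_ : 0 <= 1 + `|v|)) ?addr_ge0 //.
    rewrite -ltr_pdivlMr ?ltr_pwDl //; near: h.
    by apply: dnbhs0_lt; rewrite divr_gt0 // ltr_pwDl.
  have hv : `|h *: v| < d.
    rewrite normrZ (le_lt_trans _ hd) // normrM ler_wpM2l //.
    by rewrite ger0_norm ?addr_ge0 // lerDr.
  have := fd (h *: v + x) x; rewrite addrK subrr normr0 => /(_ hv d0).
  rewrite (blinZ fL.1) => hh /=.
  have -> : L v - h^-1 *: (f (h *: v + x) - f x) =
      - h^-1 *: (f (h *: v + x) - f x - h *: L v).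
    by rewrite scaleNr -scalerN opprB [in RHS]scalerBr scalerA mulVf // scale1r.
  rewrite normrZ normrN normfV ler_pdivrMl ?normr_gt0 //.
  rewrite (le_trans hh) // normrZ mulrCA ler_wpM2l //.
  by rewrite -mulrA ger_pMr // mulrC ler_pdivrMr ?ltr_pwDl // mul1r lerDr.
by split; [apply/cvg_ex; exists (L v)|exact/cvg_lim].
Unshelve. all: by end_near. Qed.

End StrictDiff.

(** * From continuous directional derivatives to strict differentiability *)

Section ContinuouslyDifferentiable.
Context {R : realType}.
Implicit Types E F : normedModType R.

(** The mean value theorem applied to [g], with its slope compared to [l]. The endpoints may come in
    either order because the coordinates of a displacement may be negative. *)
Lemma mean_value_le (g dg : R -> R) (a b l e : R) :
  (forall t, Num.min a b <= t <= Num.max a b ->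
     is_derive t (1 : R) g (dg t) /\ `|dg t - l| <= e) ->
  `|g b - g a - (b - a) * l| <= e * `|b - a|.
Proof.
wlog ab : a b / a <= b => [H|].
  have [ab|/ltW ba] := leP a b => gab.
    by apply: H => // t; rewrite min_l ?max_r //; exact: gab.
  have -> : g b - g a - (b - a) * l = - (g a - g b - (a - b) * l) by ring.
  rewrite normrN [`|b - a|]distrC.
  by apply: H => // t; rewrite min_l ?max_r //; exact: gab.
move=> gab; have {}gab t : a <= t <= b -> is_derive t (1 : R) g (dg t) /\ `|dg t - l| <= e.
  by move=> atb; apply: gab; rewrite min_l ?max_r.
have [||c cab ->] := @MVT_segment _ g dg a b ab.
- by move=> t /[!in_itv]/= /andP[/ltW ta /ltW tb]; apply: (gab t _).1; rewrite ta.
- apply: derivable_within_continuous => t /[!in_itv]/= tab.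
  by have [+ _] := gab _ tab; case.
rewrite -[X in _ - X]mulrC -mulrBl normrM ler_wpM2r //.
by apply: (gab _ _).2; move: cab; rewrite in_itv.
Qed.

Lemma is_derive_line E (f : E -> R^o) (y w : E) (t : R) :
  derivable f (y + t *: w) w ->
  is_derive t (1 : R) (fun s : R => f (y + s *: w) : R) ('D_w f (y + t *: w)).
Proof.
move=> fd.
have e : (fun h : R => h^-1 *: (((fun s : R => f (y + s *: w) : R) \o shift t)
      (h *: (1 : R)) - f (y + t *: w))) =
   (fun h : R => h^-1 *: ((f \o shift (y + t *: w)) (h *: w) - f (y + t *: w))).
  apply/funext => h /=; congr (_ *: (f _ - _)).
  by rewrite scalerDl [h *: 1]mulr1 addrCA.
by split; rewrite /derivable /derive e.
Qed.

Section Scalar.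
Context {E : normedModType R}.
(** Directions [e] with coordinate functionals [c]. They are indexed by natural numbers so that
    partial sums can be formed and used in inductions. *)
Variables (f : E -> R^o) (x : E) (n : nat) (e : nat -> E) (c : nat -> E -> R^o).
Hypothesis cb : forall i, blin (c i).
Hypothesis ec : forall h, h = \sum_(i < n) c i h *: e i.
Hypothesis fd : forall i, \forall y \near x, derivable f y (e i).
Hypothesis fc : forall i, {for x, continuous ('D_(e i) f)}.

Lemma near_direction_bound (eps : R) : 0 < eps -> exists2 d : R, 0 < d &
  forall i, (i < n)%N -> forall y, `|y - x| < d ->
    derivable f y (e i) /\ `|'D_(e i) f y - 'D_(e i) f x| <= eps.
Proof.
move=> eps0; elim: n => [|m [d d0 dP]]; first by exists 1.
have [d1 /= d10 d1P] := (nbhs_normP _ _).1 (fd m).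
have /cvgrPdist_le/(_ _ eps0)/nbhs_normP[d2 /= d20 d2P] := @fc m.
exists (Num.min d (Num.min d1 d2)); first by rewrite !lt_min d0 d10 d20.
move=> i im y; rewrite !lt_min => /and3P[yd y1 y2].
move: im; rewrite ltnS leq_eqVlt => /orP[/eqP->|im]; last exact: dP.
split; first by apply: d1P; rewrite /ball_ /= distrC.
by rewrite distrC; apply: d2P; rewrite /ball_ /= distrC.
Qed.

(* Move from [z] to [y] one direction [e i] at a time and apply the mean value
   theorem to each leg. *)
Lemma strict_diff_C1_scalar :
  strict_diff f x (fun h => \sum_(i < n) c i h *: 'D_(e i) f x).
Proof.
split=> [|eps eps0].
  apply: (@blin_sumf _ _ _ _ (fun i h => c i h *: ('D_(e i) f x : R^o))) => i.
  exact: blin_scaler.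
pose k i := sval (cid2 (cb i).2).
have k0 i : 0 <= k i by rewrite /k; case: cid2.
have ck i h : `|c i h| <= k i * `|h| by rewrite /k; case: cid2.
pose S := \sum_(i < n) k i; pose T := \sum_(i < n) k i * `|e i|.
have S0 : 0 <= S by exact: sumr_ge0.
have T0 : 0 <= T by apply: sumr_ge0 => i _; exact: mulr_ge0.
have e1 : 0 < eps / (1 + S) by rewrite divr_gt0 // ltr_pwDl.
have [d d0 dP] := near_direction_bound e1.
(* The start [z] is within [d'] of [x] and the legs add up to at most [T * (2 * d')], so the factor
   [1 + 2 * T] keeps all intermediate points within [d]. *)
exists (d / (1 + 2 * T)) => [|y z yd zd].
  by rewrite divr_gt0 // ltr_pwDl // mulr_ge0.
set d' := d / _ in yd zd.
pose h := y - z.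
pose p m := z + \sum_(i < m) c i h *: e i.
have hd : `|h| <= 2 * d'.
  rewrite /h -(subrK x y) -addrA (le_trans (ler_normD _ _)) //.
  by rewrite mulr2n mulrDl mul1r lerD // ltW // distrC.
have pd m : (m <= n)%N -> `|p m - x| < d.
  move=> mn; rewrite /p addrAC (le_lt_trans (ler_normD _ _)) //.
  have le1 : `|\sum_(i < m) c i h *: e i| <= T * (2 * d').
    rewrite (le_trans (ler_norm_sum _ _ _)) //.
    rewrite (@le_trans _ _ ((\sum_(i < m) k i * `|e i|) * (2 * d'))) //.
      rewrite mulr_suml ler_sum // => i _; rewrite normrZ mulrAC ler_wpM2r //.
      by rewrite (le_trans (ck _ _)) // ler_wpM2l.
    rewrite ler_wpM2r ?(le_trans _ hd) // /T -!(big_mkord predT (fun i => k i * `|e i|)).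
    rewrite [leRHS](big_cat_nat (n := m)) //= lerDl sumr_ge0 // => i _.
    exact: mulr_ge0.
  rewrite (lt_le_trans (ltr_leD zd le1)) // mulrCA mulrA -{1}[d']mul1r -mulrDl.
  by rewrite /d' mulrC mulfVK // gt_eqF // ltr_pwDl // mulr_ge0.
have main m : (m <= n)%N ->
   `|f (p m) - f z - \sum_(i < m) c i h *: ('D_(e i) f x : R^o)| <=
   eps / (1 + S) * ((\sum_(i < m) k i) * `|h|).
  elim: m => [|m ih] mn.
    by rewrite /p !big_ord0 addr0 !subrr normr0 mul0r mulr0.
  have step : `|f (p m.+1) - f (p m) - c m h * ('D_(e m) f x)| <=
       eps / (1 + S) * (k m * `|h|).
    have pm1 : p m.+1 = p m + c m h *: e m by rewrite /p big_ord_recr /= addrA.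
    have := @mean_value_le (fun s : R => f (p m + s *: e m))
      (fun s => 'D_(e m) f (p m + s *: e m)) 0 (c m h) ('D_(e m) f x)
      (eps / (1 + S)).
    rewrite scale0r addr0 subr0 pm1 => H; apply: (le_trans (H _)) => [s sc|].
      have sd : `|p m + s *: e m - x| < d.
        have [/eqP c0|c0] := boolP (c m h == 0).
          move: sc; rewrite c0 minxx maxxx -eq_le => /eqP <-.
          by rewrite scale0r addr0 pd // ltnW.
        have [u u01 su] : exists2 u : R, 0 <= u <= 1 & s = u * c m h.
          exists (s / c m h); last by rewrite mulfVK.
          case: (ltrgt0P (c m h)) c0 sc => // cp _.
            move=> /andP[s0 sc].
            by rewrite divr_ge0 ?(ltW cp) //= ler_pdivrMr // mul1r.
          move=> /andP[sc s0].
          by rewrite mulr_le0 ?invr_le0 ?(ltW cp) //= ler_ndivrMr // mul1r.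
        (* Convexity of the ball: each point of a leg is a convex combination of its two end
           points. *)
        have -> : p m + s *: e m - x = (1 - u) *: (p m - x) + u *: (p m.+1 - x).
          rewrite pm1 [p m + c m h *: _ - x]addrAC [u *: (_ + c m h *: _)]scalerDr.
          rewrite addrA -scalerDl subrK scale1r scalerA.
          by rewrite su addrAC.
        case/andP: u01 => u0 u1.
        rewrite (le_lt_trans (ler_normD _ _)) // !normrZ (ger0_norm u0).
        rewrite (@ger0_norm _ (1 - u)) ?subr_ge0 //.
        have p1 := pd _ (ltnW mn); have p2 := pd _ mn.
        have [->|un] := eqVneq u 0; first by rewrite subr0 mul1r mul0r addr0.
        have -> : d = (1 - u) * d + u * d by rewrite -mulrDl subrK mul1r.
        apply: ler_ltD; first by rewrite ler_wpM2l ?subr_ge0 // ltW.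
        by rewrite ltr_pM2l // lt_neqAle eq_sym un.
      have [h1 h2] := dP _ mn _ sd.
      by split; [exact: is_derive_line h1|exact: h2].
    by rewrite ler_wpM2l // ltW.
  rewrite !big_ord_recr /= mulrDl mulrDr.
  rewrite (le_trans _ (lerD (ih (ltnW mn)) step)) // (le_trans _ (ler_normD _ _)) //.
  rewrite le_eqVlt; apply/orP; left; apply/eqP; congr (`|_|).
  set D := \sum_(i < m) _.
  by rewrite -[c m h *: _]/(c m h * _); ring.
have := main n (leqnn n).
have -> : p n = y by rewrite /p -ec /h addrC subrK.
move=> /le_trans; apply; rewrite mulrA ler_wpM2r // mulrAC ler_pdivrMr ?ltr_pwDl //.
by rewrite ler_wpM2l ?lerDr // ltW.
Qed.

End Scalar.

Lemma strict_diff_real (f df : R -> R) (x : R) :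
  (\forall y \near x, is_derive y (1 : R) f (df y)) -> {for x, continuous df} ->
  strict_diff (f : R^o -> R^o) x (fun h => h * df x).
Proof.
move=> fd fc.
have fdx := nbhs_singleton fd.
have := @strict_diff_C1_scalar R^o (f : R^o -> R^o) x 1 (fun=> 1) (fun=> id).
move=> /(_ (fun=> blin_id _)) H.
have {}H : strict_diff (f : R^o -> R^o) x
    (fun h => \sum_(i < 1) (h : R^o) *: ('D_(1 : R^o) (f : R^o -> R^o) x : R^o)).
  apply: H => [h|_|_].
  - by rewrite big_ord1 [RHS]mulr1.
  - by apply: filterS fd => y [].
  - apply: cvg_trans; last by rewrite (@derive_val _ _ _ _ _ _ _ fdx); exact: fc.
    apply: near_eq_cvg; apply: filterS fd => y fy.
    by rewrite (@derive_val _ _ _ _ _ _ _ fy).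
apply: strict_diff_eq H (frefl _) _ => h.
by rewrite big_ord1 (@derive_val _ _ _ _ _ _ _ fdx).
Qed.

End ContinuouslyDifferentiable.

(** * Elementary functions, and maps of class C1 and C2 on a finite-dimensional product *)

Section StrictDiffFunctions.
Context {R : realType}.
Implicit Types E F : normedModType R.

Lemma strict_diff_inv E (f : E -> R^o) x L : f x != 0 -> strict_diff f x L ->
  strict_diff (fun z => (f z)^-1 : R^o) x (fun h => L h * - (f x) ^- 2).
Proof.
move=> fx0 fL.
apply: (strict_diff_comp (g := fun t : R^o => t^-1 : R^o)
  (L' := fun h : R^o => h * - (f x) ^- 2) erefl fL).
apply: (@strict_diff_real _ (fun t => t^-1) (fun t => - t ^- 2)).
  near=> y.
  have y0 : y != 0 by near: y; exact: (open_nbhs_nbhs (conj (@open_neq R 0) fx0)).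
  by have := is_deriveV (f := id) y0 (is_derive_id y 1); rewrite [_ *: 1]mulr1.
apply: (@continuousN R R^o R (fun t => t ^- 2)).
apply: (@continuous_comp R R R (fun t => t ^+ 2) GRing.inv); last first.
  by apply: inv_continuous; rewrite expf_neq0.
exact: exprn_continuous.
Unshelve. all: by end_near. Qed.

Lemma strict_diff_sqrt E (f : E -> R^o) x L : 0 < f x -> strict_diff f x L ->
  strict_diff (fun z => Num.sqrt (f z) : R^o) x
    (fun h => L h * (2 * Num.sqrt (f x))^-1).
Proof.
move=> fx0 fL.
apply: (strict_diff_comp (g := fun t : R^o => Num.sqrt t : R^o)
  (L' := fun h : R^o => h * (2 * Num.sqrt (f x))^-1) erefl fL).
apply: (@strict_diff_real _ Num.sqrt (fun t => (2 * Num.sqrt t)^-1)).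
  near=> y; apply: is_derive1_sqrt.
  by near: y; exact: lt_nbhsr.
apply: (@continuous_comp R R R (fun t => 2 * Num.sqrt t) GRing.inv); last first.
  by apply: inv_continuous; rewrite mulf_neq0 // gt_eqF // sqrtr_gt0.
by apply: (@continuousM R R (fun=> 2) Num.sqrt); [exact: cvg_cst|exact: sqrt_continuous].
Unshelve. all: by end_near. Qed.

Lemma strict_diff_exp E (f : E -> R^o) x L : strict_diff f x L ->
  strict_diff (fun z => expR (f z) : R^o) x (fun h => L h * expR (f x)).
Proof.
move=> fL.
apply: (strict_diff_comp (g := fun t : R^o => expR t : R^o)
  (L' := fun h : R^o => h * expR (f x)) erefl fL).
apply: (@strict_diff_real _ expR expR); last exact: continuous_expR.
by exists 1 => //= y _; exact: is_derive_expR.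
Qed.

Definition prod_dir n (i : nat) : R^o * 'rV[R]_n.+1 :=
  if i is j.+1 then (0, delta_mx 0 (inord j)) else (1, 0).

Definition prod_coord n (i : nat) (h : R^o * 'rV[R]_n.+1) : R^o :=
  if i is j.+1 then h.2 0 (inord j) else h.1.

Lemma prod_coordE n (h : R^o * 'rV[R]_n.+1) :
  h = \sum_(i < n.+2) prod_coord i h *: prod_dir n i.
Proof.
case: h => t v; rewrite big_ord_recl /=.
have -> : \sum_(i < n.+1) prod_coord (lift ord0 i) (t, v) *: prod_dir n (lift ord0 i)
   = (0, v).
  transitivity (\sum_(i < n.+1) ((0, v 0 i *: delta_mx 0 i) : R^o * 'rV[R]_n.+1)).
    apply: eq_bigr => i _; rewrite /prod_coord /prod_dir lift0 inord_val /=.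
    by congr (_, _); rewrite /= scaler0.
  rewrite -(big_morph (fun w : 'rV[R]_n.+1 => (0 : R^o, w)) (id1 := 0)
    (op1 := +%R) (id2 := 0) (op2 := +%R)) //; last by move=> u w; congr (_, _); rewrite addr0.
  by rewrite -row_sum_delta.
congr (_, _) => /=; first by rewrite [_ *: 1]mulr1 addr0.
by rewrite scaler0 add0r.
Qed.

(** [C1_on] treats each direction separately, but continuity along a finite basis suffices.
    Linearity of ['D_h f x] in [h] is part of the conclusion: the strict derivative built from the
    basis has these values. *)
Lemma strict_diff_C1 n m (f : R^o * 'rV[R]_n.+1 -> 'rV[R]_m) A x :
  (\forall y \near x, A y) -> C1_on A f ->
  strict_diff f x (fun h => 'D_h f x).
Proof.
move=> Ax fA.
have fi (i : 'I_m) e : \forall y \near x,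
    derivable (fun y => f y 0 i : R^o) y e /\
    'D_e (fun y => f y 0 i : R^o) y = ('D_e f y) 0 i.
  apply: filterS Ax => y /(fA e)[fy _]; split; first exact: (derivable_mxP _ _ _).1.
  by rewrite (derive_mx fy) mxE.
have H : strict_diff f x (fun h => \sum_(j < n.+2) prod_coord j h *: 'D_(prod_dir n j) f x).
  apply: strict_diff_row => i.
  have := @strict_diff_C1_scalar R _ (fun y => f y 0 i : R^o) x n.+2
    (prod_dir n) (@prod_coord n).
  move=> H; apply: strict_diff_eq (H _ _ _ _) (frefl _) _.
  - case=> [|j]; first exact: blin_fst.
    exact: (blin_comp (blin_snd _ _) (blin_coord _)).
  - exact: prod_coordE.
  - by move=> j; apply: filterS (fi i (prod_dir n j)) => y [].
  - move=> j; have fy := fi i (prod_dir n j).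
    have c1 : (fun y => ('D_(prod_dir n j) f y) 0 i : R^o) @ x -->
        (('D_(prod_dir n j) f x) 0 i : R^o).
      apply: (@continuous_comp _ _ _ ('D_(prod_dir n j) f) (fun v : 'rV[R]_m => v 0 i)).
        exact: (fA _ _ (nbhs_singleton Ax)).2.
      exact: coord_continuous.
    rewrite -(nbhs_singleton fy).2 in c1.
    apply: cvg_trans c1; apply: near_eq_cvg.
    by apply: filterS fy => y [].
  - move=> h; rewrite summxE; apply: eq_bigr => j _.
    by rewrite mxE (nbhs_singleton (fi i _)).2.
apply: strict_diff_eq (H) (frefl _) _ => h.
by have [_ ->] := strict_diff_is_derive h H.
Qed.

(* The mixed second difference is estimated through the Lipschitz constant of
   the derivative in the first variable. *)
Lemma C2_mixed n m (f : R^o * 'rV[R]_n.+1 -> 'rV[R]_m) A x :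
  (\forall y \near x, A y) -> C2_on A f ->
  exists2 k : R, 0 < k & exists2 d : R, 0 < d &
  forall a b t U V, `|a - x.1| < d -> `|b - x.1| < d -> `|t| < d ->
    `|U - x.2| < d -> `|V - x.2| < d ->
    `|f (a + t, U) - f (a, U) - (f (b + t, V) - f (b, V))| <=
      k * `|t| * Num.max `|a - b| `|U - V|.
Proof.
move=> Ax [fA dfA]; pose w : R^o * 'rV[R]_n.+1 := (1, 0).
have [k k0 [d1 d10 fk]] := strict_diff_lip (strict_diff_C1 Ax (dfA w)).
have [d2 /= d20 fd] := (nbhs_normP _ _).1 Ax.
exists k => //; exists (Num.min d1 d2 / 2); first by rewrite divr_gt0 // lt_min d10.
move=> a b t U V; set d := Num.min d1 d2 => ad bd td Ud Vd.
have near_seg c W s : `|c - x.1| < d / 2 -> `|W - x.2| < d / 2 ->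
    Num.min 0 t <= s <= Num.max 0 t -> `|((c, W) : R^o * _) + s *: w - x| < d.
  move=> cd Wd st.
  have sd : `|s| < d / 2.
    apply: le_lt_trans td; case: (leP 0 t) st => [t0|/ltW t0] /andP[s1 s2].
      by rewrite !ger0_norm.
    by rewrite !ler0_norm // lerN2.
  rewrite prod_normE /= scaler0 addr0 [s *: 1]mulr1 gt_max.
  rewrite (lt_trans Wd) ?andbT; last first.
    by rewrite ltr_pdivrMr // mulr2n mulrDr mulr1 ltrDl lt_min d10.
  rewrite addrAC (le_lt_trans (ler_normD _ _)) // (splitr d) ltrD //.
have dI (p : R^o * 'rV[R]_n.+1) (i : 'I_m) : `|p - x| < d ->
    derivable (fun y => f y 0 i : R^o) p w /\
    'D_w (fun y => f y 0 i : R^o) p = ('D_w f p) 0 i.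
  rewrite lt_min => /andP[_ pd].
  have Ap : A p by apply: fd; rewrite /ball_ /= distrC.
  have [fp _] := fA w p Ap; split; first exact: (derivable_mxP _ _ _).1.
  by rewrite (derive_mx fp) mxE.
apply: mx_norm_le => [|i].
  by rewrite !mulr_ge0 ?(ltW k0) // le_max normr_ge0.
(* The mean value theorem is scalar, so one coordinate is taken at a time. The increment of [g] over
   [[0, t]] is that coordinate of the mixed difference, and its derivative compares ['D_w f] at two
   points whose displacement does not depend on [s]. *)
pose g (s : R) : R := f ((a, U) + s *: w) 0 i - f ((b, V) + s *: w) 0 i.
have gE s : g s = (f (a + s, U) - f (b + s, V)) 0 i.
  rewrite /g !mxE; congr (f _ 0 i - f _ 0 i).
    by congr (_, _); rewrite /= ?scaler0 ?addr0 // [s *: 1]mulr1.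
  by congr (_, _); rewrite /= ?scaler0 ?addr0 // [s *: 1]mulr1.
have := @mean_value_le _ g
  (fun s => 'D_w f ((a, U) + s *: w) 0 i - 'D_w f ((b, V) + s *: w) 0 i)
  0 t 0 (k * Num.max `|a - b| `|U - V|).
rewrite !gE mulr0 !subr0 !addr0 => H.
rewrite (_ : _ 0 i = (f (a + t, U) - f (b + t, V)) 0 i -
    (f (a, U) - f (b, V)) 0 i); last by rewrite !mxE; ring.
rewrite mulrAC; apply: H => s st.
have aS := near_seg a U s ad Ud st; have bS := near_seg b V s bd Vd st.
have [a1 a2] := dI _ i aS; have [b1 b2] := dI _ i bS.
split.
  rewrite -a2 -b2; apply: is_deriveB.
    exact: (@is_derive_line _ _ (fun p => f p 0 i) (a, U) w s a1).
  exact: (@is_derive_line _ _ (fun p => f p 0 i) (b, V) w s b1).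
rewrite subr0.
have -> : 'D_w f ((a, U) + s *: w) 0 i - 'D_w f ((b, V) + s *: w) 0 i =
   ('D_w f ((a, U) + s *: w) - 'D_w f ((b, V) + s *: w)) 0 i by rewrite !mxE.
rewrite (le_trans (mx_norm_coord _ _)) //.
move: aS bS; rewrite !lt_min => /andP[aS _] /andP[bS _].
rewrite (le_trans (fk _ _ aS bS)) // ler_wpM2l ?(ltW k0) //.
by rewrite opprD addrACA subrr addr0 prod_normE.
Qed.

End StrictDiffFunctions.

(* The library has no join of the complete and the normed structure of matrices. *)
HB.instance Definition _ (R : realType) (m n : nat) :=
  Complete.copy (matrix R m n) (matrix R m n).

(** * Inverse function theorem with a parameter *)

Section StrictInverse.
Context {R : realType} {X : completeNormedModType R} {P Y : normedModType R}.
(** [B] is the inverse of the derivative of [F] in its first variable. [BL] makes it a left inverse;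
    [B_inj] is what turns a zero of [B (F (z, U) - V)] into a solution of [F (z, U) = V]. *)
Variables (F : X * P -> Y) (z0 : X) (U0 : P) (L : X * P -> Y) (B : Y -> X).
Hypothesis FL : strict_diff F (z0, U0) L.
Hypothesis Bb : blin B.
Hypothesis BL : forall h, B (L (h, 0)) = h.
Hypothesis B_inj : forall w, B w = 0 -> w = 0.

(** Since [B] undoes the derivative in [z], the map [z - B (F (z, U))] has zero derivative in [z] at
    the base point, hence an arbitrarily small Lipschitz constant nearby, uniformly in [U]. *)
Lemma strict_inverse_approx (e : R) : 0 < e -> exists2 d : R, 0 < d &
  forall z z' U, `|z - z0| < d -> `|z' - z0| < d -> `|U - U0| < d ->
    `|z - z' - B (F (z, U) - F (z', U))| <= e * `|z - z'|.
Proof.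
move=> e0; have [_ [k k0 Bk]] := Bb.
have e1 : 0 < e / (1 + k) by rewrite divr_gt0 // ltr_pwDl.
have [d d0 Fd] := FL.2 _ e1; exists d => // z z' U zd zd' Ud.
have {}Fd : `|F (z, U) - F (z', U) - L (z - z', 0)| <= e / (1 + k) * `|z - z'|.
  have dE : (z, U) - (z', U) = (z - z', 0) by congr (_, _); rewrite /= subrr.
  have := Fd (z, U) (z', U).
  rewrite dE !prod_normE /= !gt_max zd zd' Ud => /(_ isT isT).
  by rewrite normr0 (max_l (normr_ge0 _)).
rewrite -{1}(BL (z - z')) -(blinB Bb) (le_trans (Bk _)) // distrC.
rewrite (le_trans (ler_wpM2l k0 Fd)) // mulrA ler_wpM2r //.
by rewrite mulrCA ger_pMr // ler_pdivrMr ?ltr_pwDl // mul1r lerDr.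
Qed.

(** Contraction factor 1/2 gives both halves: absorbing [2^-1 * |z - z'|] on the left bounds
    [z - z'] by the values of [F], and Banach's theorem solves [F (z, U) = V]. The radius [rho] is
    left to the caller, who will need solutions within a prescribed smallness. *)
Lemma strict_inverse : exists r C : R, [/\ 0 < r, 0 < C,
    forall z z' U, `|z - z0| < r -> `|z' - z0| < r -> `|U - U0| < r ->
      `|z - z'| <= C * `|F (z, U) - F (z', U)|
  & forall rho : R, 0 < rho -> exists2 eps : R, 0 < eps &
      forall U V, `|U - U0| < eps -> `|V - F (z0, U0)| < eps ->
        exists2 z, `|z - z0| < rho & F (z, U) = V].
Proof.
have h0 : (0 : R) < 2^-1 by rewrite invr_gt0.
have [r r0 Fr] := strict_inverse_approx h0.
have [_ [k k0 Bk]] := Bb.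
exists r, (2 * (1 + k)); split=> //; first by rewrite mulr_gt0 // ltr_pwDl.
  move=> z z' U zr zr' Ur.
  have H := Fr _ _ _ zr zr' Ur.
  have h1 : `|z - z'| <= 2^-1 * `|z - z'| + k * `|F (z, U) - F (z', U)|.
    rewrite -{1}(subrK (B (F (z, U) - F (z', U))) (z - z')).
    by rewrite (le_trans (ler_normD _ _)) // lerD.
  have h2 := normr_ge0 (F (z, U) - F (z', U)).
  move: h1 h2; set a := `|z - z'|; set b := `|F _ - _| => h1 h2.
  have half (u c : R) : u <= 2^-1 * u + c -> u <= 2 * c by lra.
  have h3 := half _ _ h1.
  by rewrite (le_trans h3) // mulrDr mulr1 mulrDl mulrA lerDr mulr_ge0.
move=> rho rho0.
pose r' := Num.min rho r / 2.
have r'0 : 0 < r' by rewrite divr_gt0 // lt_min rho0.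
have r'r : r' < r.
  by rewrite /r' ltr_pdivrMr // gt_min ltr_pMr // ltr1n orbT.
have r'rho : r' < rho.
  by rewrite /r' ltr_pdivrMr // gt_min ltr_pMr // ltr1n.
(* Both [F (z0, U)] and [V] will be within this distance of [F (z0, U0)], so the first iterate moves
   [z0] by at most [r' / 2]; the contraction uses up the other half of the ball. *)
have e1 : 0 < r' / (4 * (1 + k)) by rewrite divr_gt0 // mulr_gt0 // ltr_pwDl.
have [d d0 Fd] := strict_diff_near FL e1.
exists (Num.min (Num.min d r) (r' / (4 * (1 + k)))).
  by rewrite !lt_min d0 r0.
move=> U V; rewrite !lt_min => /andP[/andP[Ud Ur] _] /andP[_ Ve].
(* Newton's iteration with the derivative frozen at the base point. *)
pose T z := z - B (F (z, U) - V).
have TT z z' : `|z - z0| <= r' -> `|z' - z0| <= r' -> `|T z - T z'| <= 2^-1 * `|z - z'|.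
  move=> zr zr'; have := Fr _ _ _ (le_lt_trans zr r'r) (le_lt_trans zr' r'r) Ur.
  rewrite (_ : F (z, U) - F (z', U) = (F (z, U) - V) - (F (z', U) - V)).
    by rewrite [B (_ - _)](blinB Bb) /T !opprD !opprK [in X in X -> _]addrACA.
  by rewrite opprB addrA subrK.
pose D := closed_ball_ (@Num.norm R X) z0 r'.
have DP z : D z <-> `|z - z0| <= r' by rewrite /D /closed_ball_ /= distrC.
have Dz0 : D z0 by apply/DP; rewrite subrr normr0 ltW.
have TD : {homo T : z / D z >-> D z}.
  move=> z /DP zD; apply/DP; rewrite -(subrK (T z0) (T z)) -addrA.
  rewrite (le_trans (ler_normD _ _)) // (splitr r') lerD //.
    have z0D : `|z0 - z0| <= r' by rewrite subrr normr0 ltW.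
    by rewrite (le_trans (TT _ _ zD z0D)) // mulrC ler_pdivrMr // divfK.
  rewrite /T addrAC subrr add0r normrN (le_trans (Bk _)) //.
  have h : `|F (z0, U) - V| <= 2 * (r' / (4 * (1 + k))).
    rewrite -(subrK (F (z0, U0)) (F (z0, U))) -addrA (le_trans (ler_normD _ _)) //.
    rewrite mulr2n mulrDl mul1r lerD // ?[`|_ - V|]distrC ?(ltW Ve) // ltW // Fd //.
    by rewrite prod_normE /= subrr normr0 (max_r (normr_ge0 _)).
  rewrite (le_trans (ler_wpM2l k0 h)) //.
  have -> : k * (2 * (r' / (4 * (1 + k)))) = k / (1 + k) * (r' / 2).
    by field; rewrite gt_eqF // ltr_pwDl.
  have k1 : k / (1 + k) <= 1 by rewrite ler_pdivrMr ?ltr_pwDl // mul1r lerDr.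
  by rewrite -[leRHS]mul1r ler_wpM2r // divr_ge0 // ltW.
have [|||p /DP pD pT] := @banach_fixed_point R X D (mkfun_fun TD).
- exists (2^-1)%:nng; split; first by rewrite /= invf_lt1 // ltr1n.
  by move=> [z z'] /= [/DP zD /DP zD']; exact: TT.
- exact: closed_closed_ball_.
- by exists z0.
exists p; first exact: le_lt_trans pD r'rho.
apply/eqP; rewrite -subr_eq0; apply/eqP/B_inj.
by move/(congr1 (fun q => p - q)): pT; rewrite /= subrr /mkfun /T opprB addrCA subrr addr0.
Qed.

End StrictInverse.

(** * Calculus of strict derivatives along one direction *)

Section DirectionalValue.
Context {R : realType}.
Implicit Types E F : normedModType R.

Lemma strict_diff_near_eq E F (f g : E -> F) x L (r : R) : 0 < r ->
  (forall y, `|y - x| < r -> f y = g y) -> strict_diff f x L -> strict_diff g x L.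
Proof.
move=> r0 fg [Lb fL]; split=> // e e0; have [d d0 fd] := fL e e0.
exists (Num.min r d) => [|y z]; first by rewrite lt_min r0.
by rewrite !lt_min => /andP[yr yd] /andP[zr zd]; rewrite -!fg //; exact: fd.
Qed.

Lemma strict_diff_unique E F (f : E -> F) x L L' :
  strict_diff f x L -> strict_diff f x L' -> L =1 L'.
Proof.
move=> fL fL' v.
by have [_ <-] := strict_diff_is_derive v fL; have [_ <-] := strict_diff_is_derive v fL'.
Qed.

Lemma strict_diff_lt E (f g : E -> R^o) x L L' :
  strict_diff f x L -> strict_diff g x L' -> f x < g x ->
  exists2 d : R, 0 < d & forall y, `|y - x| < d -> f y < g y.
Proof.
move=> fL gL fg; have gf0 : 0 < g x - f x by rewrite subr_gt0.
have [d d0 H] := strict_diff_near (strict_diffB gL fL) gf0.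
exists d => // y /H; rewrite ltr_norml => /andP[+ _].
by rewrite -subr_gt0 opprK subrK subr_gt0.
Qed.

(** Recording only the value in one direction lets explicit formulas be differentiated without
    writing down linear maps, while strict differentiability is carried along. *)
Definition sdiff_dir E F (f : E -> F) (x v : E) (d : F) : Prop :=
  exists2 L, strict_diff f x L & L v = d.

Section Rules.
Context {E : normedModType R} {x v : E}.
Implicit Types (f g : E -> R^o) (d : R).

Lemma sdiff_dir_eq F (f g : E -> F) (d d' : F) :
  sdiff_dir f x v d -> f =1 g -> d = d' -> sdiff_dir g x v d'.
Proof. by move=> [L fL <-] /funext <- <-; exists L. Qed.

Lemma sdiff_dir_blin F (L : E -> F) : blin L -> sdiff_dir L x v (L v).
Proof. by move=> Lb; exists L => //; exact: strict_diff_blin. Qed.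

Lemma sdiff_dir_cst F (c : F) : sdiff_dir (fun=> c) x v 0.
Proof. by exists (fun=> 0) => //; exact: strict_diff_cst. Qed.

Lemma sdiff_dirD F (f g : E -> F) (d d' : F) :
  sdiff_dir f x v d -> sdiff_dir g x v d' -> sdiff_dir (fun z => f z + g z) x v (d + d').
Proof.
move=> [L fL <-] [L' gL <-].
by exists (fun h => L h + L' h) => //; exact: strict_diffD.
Qed.

Lemma sdiff_dirB F (f g : E -> F) (d d' : F) :
  sdiff_dir f x v d -> sdiff_dir g x v d' -> sdiff_dir (fun z => f z - g z) x v (d - d').
Proof.
move=> [L fL <-] [L' gL <-].
by exists (fun h => L h - L' h) => //; exact: strict_diffB.
Qed.

Lemma sdiff_dirM f g d d' :
  sdiff_dir f x v d -> sdiff_dir g x v d' ->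
  sdiff_dir (fun z => f z * g z : R^o) x v (f x * d' + g x * d).
Proof.
move=> [L fL <-] [L' gL <-].
by exists (fun h => f x * L' h + g x * L h) => //; exact: strict_diffM.
Qed.

Lemma sdiff_dir_sqr f d : sdiff_dir f x v d ->
  sdiff_dir (fun z => f z ^+ 2 : R^o) x v (2 * f x * d).
Proof.
move=> fd; apply: sdiff_dir_eq (sdiff_dirM fd fd) _ _ => [z|].
  by rewrite expr2.
by rewrite mulr2n mulrDl mul1r mulrDl.
Qed.

Lemma sdiff_dirV f d : sdiff_dir f x v d -> f x != 0 ->
  sdiff_dir (fun z => (f z)^-1 : R^o) x v (d * - (f x) ^- 2).
Proof.
move=> [L fL <-] fx0.
by exists (fun h => L h * - (f x) ^- 2) => //; exact: strict_diff_inv.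
Qed.

Lemma sdiff_dir_sqrt f d : sdiff_dir f x v d -> 0 < f x ->
  sdiff_dir (fun z => Num.sqrt (f z) : R^o) x v (d * (2 * Num.sqrt (f x))^-1).
Proof.
move=> [L fL <-] fx0.
by exists (fun h => L h * (2 * Num.sqrt (f x))^-1) => //; exact: strict_diff_sqrt.
Qed.

Lemma sdiff_dir_row n (f : E -> 'rV[R]_n) (d : 'rV[R]_n) :
  (forall i, sdiff_dir (fun z => f z 0 i : R^o) x v (d 0 i : R^o)) ->
  sdiff_dir f x v d.
Proof.
move=> fd; pose l i := sval (cid2 (fd i)).
exists (fun h => \row_i l i h).
  apply: strict_diff_row => i.
  apply: strict_diff_eq (_ : strict_diff _ x (l i)) (frefl _) _ => [|h].
    by rewrite /l; case: cid2.
  by rewrite mxE.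
by apply/rowP => i; rewrite mxE /l; case: cid2.
Qed.

End Rules.
End DirectionalValue.

(** * Coordinates of gas states *)

Section States.
Context {R : realType}.
Implicit Types (U V : 'rV[R]_4).

Lemma vec4E (a b c d : R) : let U := vec4 a b c d in
  (velu U = a) * (velv U = b) * (pres U = c) * (dens U = d).
Proof. by rewrite /velu /velv /pres /dens /vec4 !mxE !inordK. Qed.

Lemma ord4P (P : 'I_4 -> Prop) :
  P (inord 0) -> P (inord 1) -> P (inord 2) -> P (inord 3) -> forall i, P i.
Proof.
move=> P0 P1 P2 P3 i; rewrite -(inord_val i).
by case: i => -[|[|[|[|]]]].
Qed.

Lemma stateP U V : velu U = velu V -> velv U = velv V -> pres U = pres V ->
  dens U = dens V -> U = V.
Proof. by move=> *; apply/rowP; exact: ord4P. Qed.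

Lemma stateD U V : (velu (U + V) = velu U + velu V) * (velv (U + V) = velv U + velv V)
  * (pres (U + V) = pres U + pres V) * (dens (U + V) = dens U + dens V).
Proof. by rewrite /velu /velv /pres /dens !mxE. Qed.

Lemma stateN U : (velu (- U) = - velu U) * (velv (- U) = - velv U)
  * (pres (- U) = - pres U) * (dens (- U) = - dens U).
Proof. by rewrite /velu /velv /pres /dens !mxE. Qed.

Lemma stateZ (a : R) U : (velu (a *: U) = a * velu U) * (velv (a *: U) = a * velv U)
  * (pres (a *: U) = a * pres U) * (dens (a *: U) = a * dens U).
Proof. by rewrite /velu /velv /pres /dens !mxE. Qed.

Lemma state0 : (velu (0 : 'rV[R]_4) = 0) * (velv (0 : 'rV[R]_4) = 0)
  * (pres (0 : 'rV[R]_4) = 0) * (dens (0 : 'rV[R]_4) = 0).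
Proof. by rewrite /velu /velv /pres /dens !mxE. Qed.

Definition stateE := (vec4E, stateD, stateN, stateZ, state0).

Lemma blin_velu : blin (velu : 'rV[R]_4 -> R^o). Proof. exact: blin_coord. Qed.
Lemma blin_velv : blin (velv : 'rV[R]_4 -> R^o). Proof. exact: blin_coord. Qed.
Lemma blin_pres : blin (pres : 'rV[R]_4 -> R^o). Proof. exact: blin_coord. Qed.
Lemma blin_dens : blin (dens : 'rV[R]_4 -> R^o). Proof. exact: blin_coord. Qed.

Lemma sdiff_dir_vec4 (E : normedModType R) (a b c d : E -> R^o) (x v : E)
    (a' b' c' d' : R) :
  sdiff_dir a x v (a' : R^o) -> sdiff_dir b x v (b' : R^o) ->
  sdiff_dir c x v (c' : R^o) -> sdiff_dir d x v (d' : R^o) ->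
  sdiff_dir (fun z => vec4 (a z) (b z) (c z) (d z)) x v (vec4 a' b' c' d').
Proof.
move=> ha hb hc hd; apply: sdiff_dir_row; apply: ord4P.
- by apply: sdiff_dir_eq ha _ _ => [z|]; rewrite mxE inordK.
- by apply: sdiff_dir_eq hb _ _ => [z|]; rewrite mxE inordK.
- by apply: sdiff_dir_eq hc _ _ => [z|]; rewrite mxE inordK.
- by apply: sdiff_dir_eq hd _ _ => [z|]; rewrite mxE inordK.
Qed.

End States.

(** * Explicit solution of the Rankine-Hugoniot relations and its derivative in the slope *)

Section RankineHugoniot.
Context {R : realType}.
Variable gamma : R.
Hypothesis gamma_gt1 : 1 < gamma.
Implicit Types (U V : 'rV[R]_4) (s : R).

(* [cross s U] is the flow velocity across a line of slope [s], scaled by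
   [sqrt (1 + s ^+ 2)]. *)
Definition cross s U : R := velv U - s * velu U.

(* The jump of [velv] over a shock of slope [s] with lower state [U]. *)
Definition velv_jump s U : R :=
  2 / (gamma + 1) *
    (gamma * pres U / (dens U * cross s U) - cross s U / (1 + s ^+ 2)).

(** The mass flux [dens * cross] is conserved. Momentum balance then makes the velocity jump
    parallel to the normal [(- s, 1)] and the pressure jump equal to minus the mass flux times [d];
    the density is the mass flux over the new cross velocity. *)
Definition shock_state s U : 'rV[R]_4 :=
  let d := velv_jump s U in
  vec4 (velu U - s * d) (velv U + d) (pres U - dens U * cross s U * d)
    (dens U * cross s U / (cross s U + (1 + s ^+ 2) * d)).

Lemma rankine_hugoniotP s U V :
  let h W := enthalpy gamma W + (velu W ^+ 2 + velv W ^+ 2) / 2 in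
  s *: (flux_W gamma V - flux_W gamma U) = flux_H gamma V - flux_H gamma U <->
  [/\ s * (dens V * velu V - dens U * velu U) = dens V * velv V - dens U * velv U,
      s * (dens V * velu V ^+ 2 + pres V - (dens U * velu U ^+ 2 + pres U)) =
        dens V * velu V * velv V - dens U * velu U * velv U,
      s * (dens V * velu V * velv V - dens U * velu U * velv U) =
        dens V * velv V ^+ 2 + pres V - (dens U * velv U ^+ 2 + pres U)
    & s * (dens V * velu V * h V - dens U * velu U * h U) =
        dens V * velv V * h V - dens U * velv U * h U].
Proof.
move=> h; split=> [e|[e1 e2 e3 e4]].
  split; [have := congr1 velu e|have := congr1 velv e|have := congr1 pres e
         |have := congr1 dens e]; by rewrite /flux_W /flux_H /= !stateE.
by refine (stateP _ _ _ _); rewrite /flux_W /flux_H /= !stateE.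
Qed.

(** Mass and momentum balance express everything through the jump [d] of [velv], and the energy
    balance becomes quadratic in [d]. One root is [d = 0], excluded by [V != U], so the other is
    rational in the data. *)
Lemma shock_stateP s U V : 0 < dens U -> 0 < dens V -> 0 < cross s U -> V != U ->
  s *: (flux_W gamma V - flux_W gamma U) = flux_H gamma V - flux_H gamma U ->
  V = shock_state s U.
Proof.
move=> rU rV N0 VU /rankine_hugoniotP[].
move: N0; rewrite /shock_state /velv_jump /cross /enthalpy.
set u := velu U; set v := velv U; set p := pres U; set r := dens U.
set u' := velu V; set v' := velv V; set p' := pres V; set r' := dens V.
rewrite -/r -/r' in rU rV.
move=> N0 e1 e2 e3 e4.
set N := v - s * u in N0 *; pose N' := v' - s * u'.
have q0 : 0 < 1 + s ^+ 2 by rewrite ltr_pwDl // sqr_ge0.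
have m1 : r' * N' = r * N by rewrite /N' /N; lra.
have m0 : 0 < r * N by rewrite mulr_gt0.
have N'0 : 0 < N' by rewrite -(pmulr_rgt0 _ rV) m1.
have hp : p' - p = - (r * N) * (v' - v).
  have -> : - (r * N) * (v' - v) = - (r' * N') * v' + (r * N) * v by rewrite m1; ring.
  by rewrite /N' /N; lra.
have hu : u' - u = - s * (v' - v).
  have : (r * N) * (u' - u) = (r * N) * (- s * (v' - v)).
    have -> : (r * N) * (u' - u) = (r' * N') * u' - (r * N) * u by rewrite m1; ring.
    have -> : (r * N) * (- s * (v' - v)) = s * (p' - p) by rewrite hp; ring.
    by rewrite /N' /N; lra.
  by apply: mulfI; rewrite gt_eqF.
have hN : N' = N + (1 + s ^+ 2) * (v' - v).
  by rewrite /N' /N (_ : u' = u - s * (v' - v)); [ring|rewrite -mulNr -hu; ring].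
have hr' : r' = r * N / N' by rewrite -m1 mulfK // gt_eqF.
have he : gamma * p' / ((gamma - 1) * r') + (u' ^+ 2 + v' ^+ 2) / 2 =
          gamma * p / ((gamma - 1) * r) + (u ^+ 2 + v ^+ 2) / 2.
  set h' := (X in X = _); set h := (X in _ = X).
  have : (r * N) * h' = (r * N) * h.
    by rewrite -{1}m1 /N' /N; move: e4; rewrite -/h -/h' => e4; lra.
  by apply: mulfI; rewrite gt_eqF.
set d := v' - v in hp hu hN.
have u'E : u' = u - s * d by lra.
have v'E : v' = v + d by rewrite /d; lra.
have p'E : p' = p - r * N * d by lra.
have d0 : d != 0.
  apply: contra VU => /eqP d0; apply/eqP; apply: stateP.
  - by rewrite -/u -/u' u'E d0; ring.
  - by rewrite -/v -/v' v'E d0; ring.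
  - by rewrite -/p -/p' p'E d0; ring.
  - by rewrite -/r -/r' hr' hN d0 mulr0 addr0 mulfK // gt_eqF.
have dE : d = 2 / (gamma + 1) * (gamma * p / (r * N) - N / (1 + s ^+ 2)).
  have g1 : gamma - 1 != 0 by rewrite subr_eq0 gt_eqF.
  have g2 : gamma + 1 != 0 by rewrite gt_eqF // addr_gt0 // (lt_trans ltr01).
  apply: (mulfI d0).
  have q1 : 1 + s ^+ 2 != 0 by rewrite gt_eqF.
  have r1 : r != 0 by rewrite gt_eqF.
  have N1 : N != 0 by rewrite gt_eqF.
  have N'1 : N' != 0 by rewrite gt_eqF.
  have vE : v = N + s * u by rewrite /N; ring.
  (* The energy balance, with the trivial factor [d] still on both sides. *)
  have K : d * d * ((1 + s ^+ 2) * (gamma + 1) / 2) =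
      d * (gamma * p * (1 + s ^+ 2) / (r * N) - N).
    move: he; rewrite hr' u'E v'E p'E vE => he.
    apply/eqP; rewrite -subr_eq0; apply/eqP.
    move/eqP: he; rewrite -subr_eq0 => /eqP he.
    rewrite -[RHS](mulr0 (- (gamma - 1))) -[in RHS]he; clearbody N N'; rewrite hN.
    rewrite hN in N'1.
    by field; rewrite g1 r1 N1 N'1.
  apply: (mulIf (mulf_neq0 (mulf_neq0 q1 g2) (invr_neq0 (_ : (2 : R) != 0)))) => //.
  by rewrite K; field; rewrite r1 N1 g2 q1.
rewrite -dE; apply: stateP; rewrite !stateE //.
by rewrite -hN; exact: hr'.
Qed.

Lemma shock_state_rankine_hugoniot s U : 0 < dens U -> 0 < cross s U ->
  0 < cross s U + (1 + s ^+ 2) * velv_jump s U ->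
  s *: (flux_W gamma (shock_state s U) - flux_W gamma U) =
  flux_H gamma (shock_state s U) - flux_H gamma U.
Proof.
move=> r0 N0 N'0; apply/rankine_hugoniotP.
rewrite /enthalpy !stateE.
have g1 : gamma - 1 != 0 by rewrite subr_eq0 gt_eqF.
have g2 : gamma + 1 != 0 by rewrite gt_eqF // addr_gt0 // (lt_trans ltr01).
have q1 : 1 + s ^+ 2 != 0 by rewrite gt_eqF // ltr_pwDl // sqr_ge0.
have dE : velv_jump s U * ((gamma + 1) * (1 + s ^+ 2) * (dens U * cross s U)) =
    2 * (gamma * pres U * (1 + s ^+ 2) - dens U * cross s U ^+ 2).
  by rewrite /velv_jump; field; rewrite g2 q1 !gt_eqF.
have NE : velv U = cross s U + s * velu U by rewrite /cross; ring.
move: r0 N0 N'0 dE NE.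
move: (velv_jump s U) (cross s U) (velu U) (velv U) (pres U) (dens U).
move=> d N u v p r r0 N0 N'0 dE ->.
have [r1 N1 N'1] : [/\ r != 0, N != 0 & N + (1 + s ^+ 2) * d != 0] by rewrite !gt_eqF.
split.
- by field.
- by field.
- by field.
(* The relation [dE] is solved for [p] instead of [d]; with [p] eliminated, the energy balance is a
   rational identity in free variables. *)
- have pE : p = ((gamma + 1) * (1 + s ^+ 2) * (r * N) * d / 2 + r * N ^+ 2) /
      (gamma * (1 + s ^+ 2)).
    have g0 : gamma != 0 by rewrite gt_eqF // (lt_trans ltr01).
    apply: (mulIf (mulf_neq0 g0 q1)); rewrite [RHS]mulfVK ?mulf_neq0 //.
    by lra.
  rewrite pE; field; rewrite g1 q1 r1 N1 N'1 /=.
  by rewrite gt_eqF // (lt_trans ltr01).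
Qed.

Lemma supersonic_lambda2 s U : supersonic gamma U -> s < lambda2 U -> 0 < cross s U.
Proof.
move=> [_ _ cu]; have u0 : 0 < velu U by rewrite (le_lt_trans _ cu) // sqrtr_ge0.
by rewrite /lambda2 ltr_pdivlMr // /cross subr_gt0.
Qed.

Lemma shock1_stateE s U V : shock gamma 1 s U V -> V = shock_state s U.
Proof.
move=> [[Us Vs] rh /andP[l1 l2] s2 _]; have [pU rU cU] := Us; have [pV rV cV] := Vs.
apply: shock_stateP => //; first exact: supersonic_lambda2 (s2 erefl).
by apply: contraTN (lt_trans l1 l2) => /eqP ->; rewrite ltxx.
Qed.

(** The density above the shock is the positive mass flux divided by the new cross velocity, so its
    positivity passes to that velocity. *)
Lemma shock1_cross_gt0 s U : shock gamma 1 s U (shock_state s U) ->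
  0 < cross s U /\ 0 < cross s U + (1 + s ^+ 2) * velv_jump s U.
Proof.
move=> [[Us [_ + _]] _ _ s2 _]; have N0 := supersonic_lambda2 Us (s2 erefl).
have [_ r0 _] := Us.
by rewrite !stateE pmulr_rgt0 ?invr_gt0 // mulr_gt0.
Qed.

(** The derivative of [velv_jump] in [s] at fixed [U], where [cross] has derivative [- velu U];
    [pres_rate] is that of the pressure of [shock_state]. *)
Definition velv_rate s U : R :=
  2 / (gamma + 1) * (gamma * pres U * velu U / (dens U * cross s U ^+ 2) +
    velu U / (1 + s ^+ 2) + 2 * s * cross s U / (1 + s ^+ 2) ^+ 2).

Definition pres_rate s U : R :=
  - dens U * (cross s U * velv_rate s U - velu U * velv_jump s U).

(** The derivatives [a] and [b] of the [velu] and [dens] components stay unspecified: the 2- and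
    3-waves can compensate any values of these two. *)
Lemma shock_state_sdiff s U : dens U != 0 -> cross s U != 0 ->
  cross s U + (1 + s ^+ 2) * velv_jump s U != 0 ->
  exists a b, sdiff_dir (fun x : R^o * 'rV[R]_4 => shock_state x.1 x.2) (s, U) (1, 0)
    (vec4 a (velv_rate s U) (pres_rate s U) b).
Proof.
move=> r0 N0 N'0.
pose x : R^o * 'rV[R]_4 := (s, U); pose w : R^o * 'rV[R]_4 := (1, 0).
have q1 : 1 + s ^+ 2 != 0 by rewrite gt_eqF // ltr_pwDl // sqr_ge0.
have g2 : gamma + 1 != 0 by rewrite gt_eqF // addr_gt0 // (lt_trans ltr01).
have hs : sdiff_dir (fun x : R^o * 'rV[R]_4 => x.1) x w (1 : R^o).
  exact: (sdiff_dir_blin (blin_fst _ _)).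
have comp (f : 'rV[R]_4 -> R^o) : blin f ->
    sdiff_dir (fun x : R^o * 'rV[R]_4 => f x.2) x w (0 : R^o).
  move=> fb; apply: sdiff_dir_eq (sdiff_dir_blin (blin_comp (blin_snd _ _) fb)) _ _ => //.
  by rewrite /w /= (blin0 fb).
have hu := comp _ blin_velu; have hv := comp _ blin_velv.
have hp := comp _ blin_pres; have hr := comp _ blin_dens.
have hN : sdiff_dir (fun x : R^o * 'rV[R]_4 => cross x.1 x.2 : R^o) x w (- velu U : R^o).
  apply: sdiff_dir_eq (sdiff_dirB hv (sdiff_dirM hs hu)) _ _ => //.
  by rewrite /x /=; ring.
have hq : sdiff_dir (fun x : R^o * 'rV[R]_4 => 1 + x.1 ^+ 2 : R^o) x w (2 * s : R^o).
  apply: sdiff_dir_eq (sdiff_dirD (sdiff_dir_cst (1 : R^o)) (sdiff_dir_sqr hs)) _ _ => //.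
  by rewrite /x /=; ring.
have hrN := sdiff_dirM hr hN.
have rN0 : dens x.2 * cross x.1 x.2 != 0 by rewrite mulf_neq0.
have hd : sdiff_dir (fun x : R^o * 'rV[R]_4 => velv_jump x.1 x.2 : R^o) x w
    (velv_rate s U : R^o).
  have h1 := sdiff_dirM (sdiff_dirM (sdiff_dir_cst (gamma : R^o)) hp) (sdiff_dirV hrN rN0).
  have h2 := sdiff_dirM hN (sdiff_dirV hq q1).
  have h3 := sdiff_dirM (sdiff_dir_cst (2 / (gamma + 1) : R^o)) (sdiff_dirB h1 h2).
  apply: sdiff_dir_eq h3 _ _ => //.
  by rewrite /x /velv_rate /=; field; rewrite g2 q1 r0 N0.
have hN' := sdiff_dirD hN (sdiff_dirM hq hd).
have hro := sdiff_dirM hrN (sdiff_dirV hN' N'0).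
have huo := sdiff_dirB hu (sdiff_dirM hs hd).
have hvo := sdiff_dirD hv hd.
have hpo := sdiff_dirB hp (sdiff_dirM hrN hd).
eexists; eexists; apply: sdiff_dir_eq (sdiff_dir_vec4 huo hvo hpo hro) (frefl _) _.
congr vec4; first by rewrite add0r.
by rewrite /x /pres_rate /=; ring.
Qed.

(* With downstream speed [T] (horizontal) and normal speeds [N], [N'], the
   condition that the flow behind the shock is supersonic reads
   [N' * (N - N') * (gamma + 1) / 2 < T ^+ 2], and
   [(1 + s ^+ 2) ^+ 2 * T * velv_rate] is [T ^+ 2 * (N' / N - (gamma - 1) / (gamma + 1))]
   plus [2 * T ^+ 2 / (gamma + 1) - N' * (N - N')]. *)
Lemma shock_rates s U : shock gamma 1 s U (shock_state s U) ->
  velv (shock_state s U) = 0 -> 0 < velv_rate s U /\ pres_rate s U < 0.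
Proof.
move=> sh; have [N0 N'0] := shock1_cross_gt0 sh.
have [[[p0 r0 _] [p'0 r'0 c'u]] _ _ _ _] := sh.
have u'0 : 0 < velu (shock_state s U) by rewrite (le_lt_trans _ c'u) // sqrtr_ge0.
have g0 : 0 < gamma by rewrite (lt_trans ltr01).
have g1 : 0 < gamma + 1 by rewrite addr_gt0.
have q0 : 0 < 1 + s ^+ 2 by rewrite ltr_pwDl // sqr_ge0.
have {}c'u : gamma * pres (shock_state s U) / dens (shock_state s U) <
    velu (shock_state s U) ^+ 2.
  move: c'u; rewrite /sound => c'u; rewrite -[ltLHS]sqr_sqrtr.
    by rewrite ltr_pXn2r // ?nnegrE ?sqrtr_ge0 // ltW.
  by rewrite divr_ge0 ?mulr_ge0 // ltW.
rewrite /pres_rate /velv_rate.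
have dE : velv_jump s U * ((gamma + 1) * (1 + s ^+ 2) * (dens U * cross s U)) =
    2 * (gamma * pres U * (1 + s ^+ 2) - dens U * cross s U ^+ 2).
  by rewrite /velv_jump; field; rewrite !gt_eqF.
have NE : velv U = cross s U + s * velu U by rewrite /cross; ring.
move: p0 r0 p'0 r'0 c'u u'0 N0 N'0 dE NE; rewrite !stateE.
move: (velv_jump s U) (cross s U) (velu U) (velv U) (pres U) (dens U).
move=> d N u v p r p0 r0 p'0 r'0 c'u u'0 N0 N'0 dE -> vd.
pose T := u - s * d; pose N' := N + (1 + s ^+ 2) * d.
(* Horizontal flow above the shock ties the slope to the ratio of [N'] and [T]. From here on [s],
   [d], [u] and [p] become rational in [gamma], [r], [N], [N'] and [T]. *)
have N'T : N' = - s * T by rewrite /N' /T; lra.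
have T0 : T != 0 by rewrite gt_eqF.
have sE : s = - N' / T by rewrite N'T; field.
have TN0 : T ^+ 2 + N' ^+ 2 != 0 by rewrite gt_eqF // ltr_pwDl ?sqr_ge0 // exprn_gt0.
have qE : 1 + s ^+ 2 = (T ^+ 2 + N' ^+ 2) / T ^+ 2 by rewrite sE; field.
have T0' : 0 < T by [].
have N'0' : 0 < N' by [].
have uE : u = T + s * d by rewrite /T; ring.
have dE2 : d = (N' - N) * T ^+ 2 / (T ^+ 2 + N' ^+ 2).
  have -> : N' - N = (1 + s ^+ 2) * d by rewrite /N'; ring.
  by rewrite qE; field; rewrite T0 TN0.
have pE : p = r * N * ((gamma + 1) * d / 2 + N * T ^+ 2 / (T ^+ 2 + N' ^+ 2)) / gamma.
  have h : gamma * p * (1 + s ^+ 2) =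
      (gamma + 1) * (1 + s ^+ 2) * (r * N) * d / 2 + r * N ^+ 2 by lra.
  apply: (mulIf (mulf_neq0 (lt0r_neq0 g0) (lt0r_neq0 q0))).
  by rewrite mulrCA mulrA h qE; field; rewrite T0 TN0 gt_eqF.
have r'E : r * N / (N + (1 + s ^+ 2) * d) = r * N / N' by [].
move: c'u p0; rewrite r'E -/T qE pE uE dE2 sE => c'u p0.
clearbody T N'; clear -g0 g1 r0 N0 N'0' T0' T0 TN0 c'u p0.
have [N1 N'1 r1] : [/\ N != 0, N' != 0 & r != 0] by rewrite !gt_eqF.
have [g2 g3] : gamma != 0 /\ gamma + 1 != 0 by rewrite !gt_eqF.
have W0 : 0 < T ^+ 2 + N' ^+ 2 by rewrite addr_gt0 ?exprn_gt0.
(* Positivity of the pressure below the shock limits the compression: up to a positive factor, [p]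
   is this expression. *)
have N'a : 0 < (gamma + 1) * N' - (gamma - 1) * N.
  rewrite -(pmulr_rgt0 _ (_ : 0 < r * N * T ^+ 2 / (2 * gamma * (T ^+ 2 + N' ^+ 2)))).
    congr (0 < _): p0; field; by rewrite ?g2 ?TN0.
  by rewrite divr_gt0 ?mulr_gt0 ?exprn_gt0.
(* Supersonic flow above the shock, cleared of denominators. *)
have Ta : 0 < 2 * T ^+ 2 - N' * (N - N') * (gamma + 1).
  move: c'u; rewrite -subr_gt0 => c'u.
  rewrite -(pmulr_rgt0 _ (_ : 0 < T ^+ 2 / (2 * (T ^+ 2 + N' ^+ 2)))).
    congr (0 < _): c'u; field; by rewrite ?g2 ?r1 ?N1 ?N'1 ?T0 ?TN0.
  by rewrite divr_gt0 ?mulr_gt0 ?exprn_gt0.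
split.
  rewrite [ltRHS](_ : _ = T ^+ 3 / ((gamma + 1) * N * (T ^+ 2 + N' ^+ 2) ^+ 2) *
      (T ^+ 2 * ((gamma + 1) * N' - (gamma - 1) * N) +
       N * (2 * T ^+ 2 - N' * (N - N') * (gamma + 1)))).
    by rewrite mulr_gt0 ?divr_gt0 ?addr_gt0 ?mulr_gt0 ?exprn_gt0.
  by field; rewrite ?g2 ?g3 ?r1 ?N1 ?T0 ?TN0.
rewrite [ltLHS](_ : _ = - (4 * r * N * T ^+ 5 / ((gamma + 1) * (T ^+ 2 + N' ^+ 2) ^+ 2))).
  by rewrite oppr_lt0 divr_gt0 ?mulr_gt0 ?exprn_gt0.
by field; rewrite ?g2 ?g3 ?r1 ?N1 ?T0 ?TN0.
Qed.

End RankineHugoniot.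

(** * Characteristic fields at a horizontal state, and stability of the strong shock *)

Section Characteristics.
Context {R : realType}.
Variable gamma : R.
Hypothesis gamma_gt1 : 1 < gamma.
Implicit Types (U V : 'rV[R]_4) (s : R).

Lemma grad_sdiff_dir (f : 'rV[R]_4 -> R) U v d :
  sdiff_dir (f : 'rV[R]_4 -> R^o) U v d -> \sum_i v 0 i * grad f U 0 i = d.
Proof.
move=> [L fL <-]; rewrite [in RHS](row_sum_delta v) (blin_sum fL.1).
apply: eq_bigr => i _; rewrite (blinZ fL.1) mxE.
by have [_ ->] := strict_diff_is_derive (delta_mx 0 i) fL.
Qed.

Lemma supersonicP U : supersonic gamma U ->
  [/\ 0 < sound gamma U, sound gamma U ^+ 2 = gamma * pres U / dens U
    & 0 < velu U ^+ 2 - sound gamma U ^+ 2].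
Proof.
move=> [p0 r0 cu]; have g0 : 0 < gamma by rewrite (lt_trans ltr01).
have c2 : 0 < gamma * pres U / dens U by rewrite divr_gt0 // mulr_gt0.
split; first by rewrite sqrtr_gt0.
  by rewrite sqr_sqrtr // ltW.
by rewrite subr_gt0 ltr_pXn2r // nnegrE ?sqrtr_ge0 // (le_trans _ (ltW cu)) // sqrtr_ge0.
Qed.

Lemma sdiff_dir_sound U v : supersonic gamma U ->
  sdiff_dir (sound gamma : 'rV[R]_4 -> R^o) U v
    (gamma * (pres v - pres U * dens v / dens U) / (2 * dens U * sound gamma U) : R^o).
Proof.
move=> Us; have [p0 r0 cu] := Us; have [c0 c2 _] := supersonicP Us.
have hp := sdiff_dir_blin (x := U) (v := v) (blin_pres (R := R)).
have hr := sdiff_dir_blin (x := U) (v := v) (blin_dens (R := R)).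
have h1 := sdiff_dirM (sdiff_dirM (sdiff_dir_cst (gamma : R^o)) hp)
  (sdiff_dirV hr (lt0r_neq0 r0)).
apply: sdiff_dir_eq (sdiff_dir_sqrt h1 _) _ _ => //.
  by rewrite -c2 exprn_gt0.
rewrite -[Num.sqrt _]/(sound gamma U); field.
by rewrite !gt_eqF.
Qed.

(** The quotient rule for [lambda] in direction [v], arranged so that [lambda] itself reappears;
    [dc] is the derivative of the sound speed. *)
Definition lambda_rate j U v : R :=
  let c := sound gamma U in
  let dc := gamma * (pres v - pres U * dens v / dens U) / (2 * dens U * c) in
  let S := Num.sqrt (velu U ^+ 2 + velv U ^+ 2 - c ^+ 2) in
  let D := velu U ^+ 2 - c ^+ 2 in
  (velu U * velv v + velv U * velu v + (- 1) ^+ j * (dc * S +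
     c * (velu U * velu v + velv U * velv v - c * dc) / S)) / D -
  lambda gamma j U * 2 * (velu U * velu v - c * dc) / D.

Lemma sdiff_dir_lambda j U v : supersonic gamma U ->
  sdiff_dir (lambda gamma j : 'rV[R]_4 -> R^o) U v (lambda_rate j U v : R^o).
Proof.
move=> Us; have [c0 c2 D0] := supersonicP Us.
have hu := sdiff_dir_blin (x := U) (v := v) (blin_velu (R := R)).
have hv := sdiff_dir_blin (x := U) (v := v) (blin_velv (R := R)).
have hc := sdiff_dir_sound v Us.
have hS1 := sdiff_dirB (sdiff_dirD (sdiff_dir_sqr hu) (sdiff_dir_sqr hv)) (sdiff_dir_sqr hc).
have hD := sdiff_dirB (sdiff_dir_sqr hu) (sdiff_dir_sqr hc).
have S0 : 0 < velu U ^+ 2 + velv U ^+ 2 - sound gamma U ^+ 2.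
  by rewrite addrAC ltr_wpDr // sqr_ge0.
have h1 := sdiff_dirM (sdiff_dirM (sdiff_dir_cst ((- 1) ^+ j : R^o)) hc)
  (sdiff_dir_sqrt hS1 S0).
have h2 := sdiff_dirM (sdiff_dirD (sdiff_dirM hu hv) h1) (sdiff_dirV hD (lt0r_neq0 D0)).
apply: sdiff_dir_eq h2 _ _ => //.
rewrite /lambda_rate /lambda; cbv zeta.
set c := sound gamma U in c0 c2 D0 S0 *.
set dc := gamma * _ / _; set S := Num.sqrt _.
have {}S0 : S != 0 by rewrite gt_eqF // sqrtr_gt0.
move: D0; set D := velu U ^+ 2 - c ^+ 2 => D0.
by field; rewrite S0 gt_eqF.
Qed.

Section Horizontal.
Variable U : 'rV[R]_4.
Hypothesis Us : supersonic gamma U.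
Hypothesis Uh : velv U = 0.
Let c := sound gamma U.
Let u := velu U.

Lemma lambda_horizontal j : lambda gamma j U = (- 1) ^+ j * (c / Num.sqrt (u ^+ 2 - c ^+ 2)).
Proof.
have [c0 _ D0] := supersonicP Us.
rewrite /lambda Uh mulr0 add0r expr0n addr0 -/c -/u.
rewrite -[X in _ / X](sqr_sqrtr (ltW D0)) -/c -/u.
field; by rewrite gt_eqF // sqrtr_gt0.
Qed.

(** The value is the same for [j = 1] and [j = 4]: at a horizontal state the reflection of the
    y-axis exchanges the two fields and changes the sign of both the eigenvalue and the raw
    eigenvector. *)
Lemma kappa_horizontal j :
  kappa gamma j U = 2 * (u ^+ 2 - c ^+ 2) ^+ 2 / ((gamma + 1) * u ^+ 3).
Proof.
have [c0 c2 D0] := supersonicP Us; have [p0 r0 cu] := Us.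
have u0 : 0 < u by rewrite (lt_trans c0).
have g1 : 0 < gamma + 1 by rewrite addr_gt0 // (lt_trans ltr01).
rewrite /kappa (grad_sdiff_dir (sdiff_dir_lambda j _ Us)).
rewrite /lambda_rate /raw_eigvec !stateE Uh lambda_horizontal expr0n addr0.
rewrite -/c -/u in c0 c2 D0 *.
set S := Num.sqrt _; have S0 : 0 < S by rewrite sqrtr_gt0.
have SD : u ^+ 2 - c ^+ 2 = S ^+ 2 by rewrite /S sqr_sqrtr ?(ltW D0).
rewrite SD; move: c2 r0 p0; set p := pres U; set r := dens U => c2 r0 p0.
(* With [p] written through [c] and [u ^+ 2 - c ^+ 2] as [S ^+ 2], no square root is left for
   [field]. *)
have pE : p = r * c ^+ 2 / gamma.
  rewrite c2; field; by rewrite !gt_eqF // (lt_trans ltr01).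
have uE : u ^+ 2 = S ^+ 2 + c ^+ 2 by rewrite -SD subrK.
have g0 : 0 < gamma by rewrite (lt_trans ltr01).
have r1 : r != 0 by rewrite gt_eqF.
clearbody p r S c u; rewrite pE.
rewrite [X in X^-1](_ : _ = (gamma + 1) * u * (S ^+ 2 + c ^+ 2) / (2 * S ^+ 4)).
  by rewrite -uE; field; rewrite !gt_eqF.
by rewrite -signr_odd; case: (odd j); rewrite ?expr1 ?expr0; field; rewrite !gt_eqF.
Qed.

(** Here [k] is the common normalization and [m] the ratio of pressure to [velv] variation in a weak
    4-wave; mirror symmetry turns it into [- m] for a 1-wave. *)
Lemma eigvec_horizontal : exists k m : R, [/\ 0 < k, 0 < m,
    velv (eigvec gamma 1 U) = k /\ pres (eigvec gamma 1 U) = - (k * m)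
  & velv (eigvec gamma 4 U) = k /\ pres (eigvec gamma 4 U) = k * m].
Proof.
have [c0 c2 D0] := supersonicP Us; have [p0 r0 cu] := Us.
have u0 : 0 < u by rewrite (lt_trans c0).
have g1 : 0 < gamma + 1 by rewrite addr_gt0 // (lt_trans ltr01).
exists (2 * (u ^+ 2 - c ^+ 2) ^+ 2 / ((gamma + 1) * u ^+ 3)).
exists (dens U * (c / Num.sqrt (u ^+ 2 - c ^+ 2)) * u); split.
- by rewrite divr_gt0 ?mulr_gt0 ?exprn_gt0.
- by rewrite !mulr_gt0 // invr_gt0 sqrtr_gt0.
- by rewrite /eigvec kappa_horizontal /raw_eigvec lambda_horizontal !stateE Uh;
    split; rewrite ?expr1 -/u; ring.
- by rewrite /eigvec kappa_horizontal /raw_eigvec lambda_horizontal !stateE Uh;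
    split; rewrite -?/u -1?signr_odd ?expr0; ring.
Qed.

End Horizontal.

Lemma near_sdiff_lt (E : normedModType R) (f g : E -> R^o) x v d d' :
  sdiff_dir f x v d -> sdiff_dir g x v d' -> f x < g x -> \forall y \near x, f y < g y.
Proof.
move=> [L fL _] [L' gL _] fg; have [e e0 H] := strict_diff_lt fL gL fg.
by apply/nbhs_normP; exists e => // y; rewrite /ball_ /= distrC; exact: H.
Qed.

(** Direction 0 is a placeholder that every linear map preserves: only the existence of a strict
    derivative is passed on. *)
Lemma sdiff_dir_comp (E F G : normedModType R) (f : E -> F) (g : F -> G) x :
  (exists d, sdiff_dir f x 0 d) -> (exists d, sdiff_dir g (f x) 0 d) ->
  exists d, sdiff_dir (fun y => g (f y)) x 0 d.
Proof.
move=> [_ [L fL _]] [_ [L' gL _]]; eexists.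
by exists (fun h => L' (L h)) => //; exact: strict_diff_comp fL gL.
Qed.

(** The admissibility conditions are strict inequalities between functions continuous in [(s, U)],
    so they persist; the Rankine-Hugoniot relations hold identically for [shock_state] as long as
    both cross velocities are positive. *)
Lemma shock1_near s U : shock gamma 1 s U (shock_state gamma s U) ->
  exists2 d : R, 0 < d & forall s' U', `|s' - s| < d -> `|U' - U| < d ->
    shock gamma 1 s' U' (shock_state gamma s' U').
Proof.
move=> sh; have [N0 N'0] := shock1_cross_gt0 sh.
have [[Us Vs] _ /andP[l1 l2] l3 _] := sh; have {}l3 := l3 erefl.
pose x : R^o * 'rV[R]_4 := (s, U); set V := shock_state gamma s U in Vs l1 *.
have [p0 r0 cu] := Us; have [p'0 r'0 cu'] := Vs.
have u0 : velu U != 0 by rewrite gt_eqF // (le_lt_trans _ cu) // sqrtr_ge0.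
have dir (E F : normedModType R) (f : E -> F) y v d :
    sdiff_dir f y v d -> exists d', sdiff_dir f y 0 d'.
  by move=> [L fL _]; exists (L 0), L.
have hG : exists d, sdiff_dir (fun y : R^o * 'rV[R]_4 => shock_state gamma y.1 y.2) x 0 d.
  have [a [b]] := shock_state_sdiff gamma_gt1 (lt0r_neq0 r0) (lt0r_neq0 N0) (lt0r_neq0 N'0).
  exact: dir.
have h2 : exists d, sdiff_dir (fun y : R^o * 'rV[R]_4 => y.2) x 0 d.
  by eexists; exact: (sdiff_dir_blin (blin_snd _ _)).
have h1 : exists d, sdiff_dir (fun y : R^o * 'rV[R]_4 => y.1) x 0 d.
  by eexists; exact: (sdiff_dir_blin (blin_fst _ _)).
have lin (f : 'rV[R]_4 -> R^o) y : blin f -> exists d, sdiff_dir f y 0 d.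
  by move=> fb; eexists; exact: sdiff_dir_blin.
have snd_ W : supersonic gamma W -> exists d, sdiff_dir (sound gamma : 'rV[R]_4 -> R^o) W 0 d.
  by move=> Ws; eexists; exact: sdiff_dir_sound.
have lam W : supersonic gamma W ->
    exists d, sdiff_dir (lambda gamma 1 : 'rV[R]_4 -> R^o) W 0 d.
  by move=> Ws; eexists; exact: sdiff_dir_lambda.
have cst0 : exists d, sdiff_dir (fun _ : R^o * 'rV[R]_4 => 0 : R^o) x 0 d.
  by eexists; exact: sdiff_dir_cst.
have lam2 : exists d, sdiff_dir (lambda2 : 'rV[R]_4 -> R^o) U 0 d.
  eexists; exact: (sdiff_dirM (sdiff_dir_blin blin_velv)
    (sdiff_dirV (sdiff_dir_blin blin_velu) u0)).
have lt (f g : R^o * 'rV[R]_4 -> R^o) : (exists d, sdiff_dir f x 0 d) ->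
    (exists d, sdiff_dir g x 0 d) -> f x < g x -> \forall y \near x, f y < g y.
  by move=> [d fd] [d' gd]; exact: near_sdiff_lt fd gd.
have n1 := lt _ _ cst0 (sdiff_dir_comp h2 (lin _ U blin_pres)) p0.
have n2 := lt _ _ cst0 (sdiff_dir_comp h2 (lin _ U blin_dens)) r0.
have n3 := lt _ _ (sdiff_dir_comp h2 (snd_ U Us)) (sdiff_dir_comp h2 (lin _ U blin_velu)) cu.
have n4 := lt _ _ cst0 (sdiff_dir_comp hG (lin _ V blin_pres)) p'0.
have n5 := lt _ _ cst0 (sdiff_dir_comp hG (lin _ V blin_dens)) r'0.
have n6 := lt _ _ (sdiff_dir_comp hG (snd_ V Vs)) (sdiff_dir_comp hG (lin _ V blin_velu)) cu'.
have n7 := lt _ _ (sdiff_dir_comp hG (lam V Vs)) h1 l1.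
have n8 := lt _ _ h1 (sdiff_dir_comp h2 (lam U Us)) l2.
have n9 := lt _ _ h1 (sdiff_dir_comp h2 lam2) l3.
have : \forall y \near x, shock gamma 1 y.1 y.2 (shock_state gamma y.1 y.2).
  apply: filterS (filterI n1 (filterI n2 (filterI n3 (filterI n4 (filterI n5
    (filterI n6 (filterI n7 (filterI n8 n9)))))))).
  move=> [s' U'] /= [p1 [r1 [c1 [p2 [r2 [c2 [k1 [k2 k3]]]]]]]].
  have U's : supersonic gamma U' by [].
  have N1 := supersonic_lambda2 U's k3.
  split=> //; last by rewrite k1.
  apply: shock_state_rankine_hugoniot => //.
  by move: r2; rewrite stateE pmulr_rgt0 ?invr_gt0 // mulr_gt0.
move=> /nbhs_normP[d /= d0 H]; exists d => // s' U' sd Ud.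
apply: (H (s', U')); rewrite /ball_ /= prod_normE /= gt_max.
by rewrite ![`|_ - (s', U').1|]distrC ![`|_ - (s', U').2|]distrC sd.
Qed.

End Characteristics.

(** * Lax curves, contact waves and the linearized reflection *)

Section WaveMaps.
Context {R : realType}.
Implicit Types (U V W : 'rV[R]_4).

Lemma blin_rV n (F : normedModType R) (f : 'rV[R]_n -> F) :
  (forall a u v, f (a *: u + v) = a *: f u + f v) -> blin f.
Proof.
move=> fl; split=> //.
have f0 : f 0 = 0.
  by have := fl (-1) 0 0; rewrite scaler0 addr0 => ->; rewrite scaleN1r addNr.
have fD : {morph f : u v / u + v} by move=> u v; have := fl 1 u v; rewrite !scale1r.
have fZ a u : f (a *: u) = a *: f u by have := fl a u 0; rewrite !addr0 f0 addr0.
exists (\sum_i `|f (delta_mx 0 i)|) => [|v]; first exact: sumr_ge0.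
rewrite [in leLHS](row_sum_delta v) (big_morph f fD f0).
rewrite (le_trans (ler_norm_sum _ _ _)) // mulr_suml ler_sum // => i _.
by rewrite fZ normrZ mulrC ler_wpM2l // mx_norm_coord.
Qed.

(** The derivative splits by linearity: along the parameter it is the prescribed eigenvector, along
    the state the identity, because [Phij 0] is the identity near [U]. The last clause is the C2
    estimate for mixed differences. *)
Lemma lax_strict_diff gamma j Phij U : lax_parametrization gamma j Phij ->
  supersonic gamma U ->
  [/\ strict_diff (fun x : R^o * 'rV[R]_4 => Phij x.1 x.2) (0, U)
        (fun h => h.1 *: eigvec gamma j U + h.2),
      exists2 d : R, 0 < d & forall V, `|V - U| < d -> Phij 0 V = V
    & exists2 k : R, 0 < k & exists2 d : R, 0 < d & forall a b t V W,
        `|a| < d -> `|b| < d -> `|t| < d -> `|V - U| < d -> `|W - U| < d ->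
        `|Phij (a + t) V - Phij a V - (Phij (b + t) W - Phij b W)| <=
          k * `|t| * Num.max `|a - b| `|V - W|].
Proof.
move=> lax Us; have [a [r [a0 r0 C2 lp]]] := lax U Us.
pose f (x : R^o * 'rV[R]_4) := Phij x.1 x.2; pose x : R^o * 'rV[R]_4 := (0, U).
set A : set (R^o * 'rV[R]_4) := [set _ | _] in C2.
have Ax : \forall y \near x, A y.
  apply/nbhs_normP; exists (Num.min a r); first by rewrite /= lt_min a0.
  move=> [t V]; rewrite /ball_ /= prod_normE /= gt_max !lt_min sub0r normrN.
  by move=> /andP[/andP[ta _] /andP[_ Vr]]; split=> //; rewrite -ball_normE.
have near0 V : `|V - U| < r -> Phij 0 V = V.
  by rewrite distrC => Vr; have [] := lp V; rewrite -?ball_normE.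
have fL := strict_diff_C1 Ax C2.1; set L := (fun h => 'D_h f x) in fL.
have L1 : L (1, 0) = eigvec gamma j U.
  have b1 : blin (fun t : R^o => (t, 0) : R^o * 'rV[R]_4).
    exact: (blin_pair (blin_id _) (blin_cst0 _ _)).
  have Ur : ball U r U by exact: ballxx.
  have [_ [_ <-] _ _ _] := lp U Ur.
  have c1 : strict_diff (fun t : R^o => (t, U) : R^o * 'rV[R]_4) (0 : R^o) (fun t => (t, 0)).
    exact: (strict_diff_pair (strict_diff_blin _ (blin_id _)) (strict_diff_cst _ _)).
  by have [_ ->] := strict_diff_is_derive (1 : R^o) (strict_diff_comp erefl c1 fL).
have L2 W : L (0, W) = W.
  have c2 : strict_diff (fun V => (0, V) : R^o * 'rV[R]_4) U (fun V => (0, V)).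
    exact: (strict_diff_pair (strict_diff_cst _ _) (strict_diff_blin _ (blin_id _))).
  have h1 := strict_diff_near_eq r0 near0 (strict_diff_comp (x := U) erefl c2 fL).
  exact: (strict_diff_unique h1 (strict_diff_blin _ (blin_id _))).
split.
- have Lb := fL.1; apply: strict_diff_eq fL (frefl _) _ => -[t W] /=.
  have -> : (t, W) = t *: ((1, 0) : R^o * 'rV[R]_4) + (0, W).
    by congr (_, _); rewrite /= ?scaler0 ?add0r // [t *: _]mulr1 addr0.
  by rewrite -/(L _) (blinD Lb) (blinZ Lb) L1 L2.
- by exists r.
- have [k k0 [d d0 H]] := C2_mixed Ax C2.
  exists k => //; exists d => // c b t V W cd bd td Vd Wd.
  by apply: H; rewrite /= ?subr0.
Qed.

Definition contact (a b : R) U : 'rV[R]_4 := Phi3 b (Phi2 a U).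

Lemma contactE a b U :
  contact a b U = vec4 (velu U * expR a) (velv U * expR a) (pres U) (dens U * expR b).
Proof. by rewrite /contact /Phi3 /Phi2 !stateE. Qed.

(** The group law behind the exact sums [alpha2 + beta2] and [alpha3 + beta3]. *)
Lemma contactD a b a' b' U :
  contact a b (contact a' b' U) = contact (a' + a) (b' + b) U.
Proof. by rewrite !contactE !stateE !expRD !mulrA. Qed.

Lemma contact0 U : contact 0 0 U = U.
Proof. by rewrite contactE; apply: stateP; rewrite !stateE ?expR0 ?mulr1. Qed.

Lemma strict_diff_contact U :
  strict_diff (fun x : (R^o * R^o) * 'rV[R]_4 => contact x.1.1 x.1.2 x.2) ((0, 0), U)
    (fun h => h.1.1 *: vec4 (velu U) (velv U) 0 0 + h.1.2 *: vec4 0 0 0 (dens U) + h.2).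
Proof.
pose x : (R^o * R^o) * 'rV[R]_4 := ((0, 0), U).
have h2 (f : 'rV[R]_4 -> R^o) : blin f -> strict_diff (fun y : (R^o * R^o) * 'rV[R]_4 => f y.2)
    x (fun h => f h.2).
  by move=> fb; apply: strict_diff_blin; exact: (blin_comp (blin_snd _ _) fb).
have ha : strict_diff (fun y : (R^o * R^o) * 'rV[R]_4 => y.1.1) x (fun h => h.1.1).
  by apply: strict_diff_blin; exact: (blin_comp (blin_fst _ _) (blin_fst _ _)).
have hb : strict_diff (fun y : (R^o * R^o) * 'rV[R]_4 => y.1.2) x (fun h => h.1.2).
  by apply: strict_diff_blin; exact: (blin_comp (blin_fst _ _) (blin_snd _ _)).
have ea := strict_diff_exp ha; have eb := strict_diff_exp hb.
have hu := strict_diffM (h2 _ blin_velu) ea; have hv := strict_diffM (h2 _ blin_velv) ea.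
have hp := h2 _ blin_pres; have hr := strict_diffM (h2 _ blin_dens) eb.
apply: strict_diff_row; apply: ord4P.
- apply: strict_diff_eq hu _ _ => [y|h].
    by rewrite -[RHS]/(velu _) contactE stateE.
  by rewrite -[RHS]/(velu _) !stateE /= expR0; ring.
- apply: strict_diff_eq hv _ _ => [y|h].
    by rewrite -[RHS]/(velv _) contactE stateE.
  by rewrite -[RHS]/(velv _) !stateE /= expR0; ring.
- apply: strict_diff_eq hp _ _ => [y|h].
    by rewrite -[RHS]/(pres _) contactE stateE.
  by rewrite -[RHS]/(pres _) !stateE /=; ring.
- apply: strict_diff_eq hr _ _ => [y|h].
    by rewrite -[RHS]/(dens _) contactE stateE.
  by rewrite -[RHS]/(dens _) !stateE /= expR0; ring.
Qed.

(** [contact a b] is a diagonal linear map of the state, so the mixed difference is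
    [contact a b - id] applied to [V - W], with entries 0, [expR a - 1] and [expR b - 1]. *)
Lemma contact_mixed : exists2 k : R, 0 < k & exists2 d : R, 0 < d &
  forall a b V W, `|a| < d -> `|b| < d ->
    `|contact a b V - V - (contact a b W - W)| <= k * Num.max `|a| `|b| * `|V - W|.
Proof.
have id0 : strict_diff (fun t : R^o => t) (0 : R^o) (fun h => h).
  exact/strict_diff_blin/blin_id.
have [k k0 [d d0 H]] := strict_diff_lip (strict_diff_exp id0).
exists k => //; exists d => // a b V W ad bd.
have e1 c : `|c| < d -> `|expR c - 1| <= k * `|c|.
  by move=> cd; have := H c 0; rewrite !subr0 normr0 expR0; apply.
have {}e1 : `|expR a - 1| <= k * Num.max `|a| `|b| /\ `|expR b - 1| <= k * Num.max `|a| `|b|.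
  split; [rewrite (le_trans (e1 a ad)) //|rewrite (le_trans (e1 b bd)) //];
    by rewrite ler_wpM2l ?(ltW k0) // le_max lexx ?orbT.
have m0 : 0 <= k * Num.max `|a| `|b| by rewrite mulr_ge0 ?(ltW k0) // le_max normr_ge0.
rewrite !contactE; apply: mx_norm_le; first exact: mulr_ge0.
apply: ord4P.
- rewrite -[_ 0 _]/(velu _) !stateE.
  rewrite (_ : _ - _ - _ = (expR a - 1) * (velu V - velu W)); last by ring.
  rewrite normrM ler_pM ?e1.1 //.
  by rewrite -[_ - _](blinB blin_velu) mx_norm_coord.
- rewrite -[_ 0 _]/(velv _) !stateE.
  rewrite (_ : _ - _ - _ = (expR a - 1) * (velv V - velv W)); last by ring.
  rewrite normrM ler_pM ?e1.1 //.
  by rewrite -[_ - _](blinB blin_velv) mx_norm_coord.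
- rewrite -[_ 0 _]/(pres _) !stateE !subrr normr0 mulr_ge0 //.
- rewrite -[_ 0 _]/(dens _) !stateE.
  rewrite (_ : _ - _ - _ = (expR b - 1) * (dens V - dens W)); last by ring.
  rewrite normrM ler_pM ?e1.2 //.
  by rewrite -[_ - _](blinB blin_dens) mx_norm_coord.
Qed.

(* Eliminating [velu] and [dens] leaves a 2x2 system, and
   [dens (B r1) = - (m * velv g + pres g) / (m * velv g - pres g)]: it has absolute
   value less than 1 because [velv g] and [pres g] have opposite signs. *)
Lemma reflection_coefficient (g r1 r4 : 'rV[R]_4) (u rho k m : R) :
  u != 0 -> rho != 0 -> 0 < k -> 0 < m -> 0 < velv g -> pres g < 0 ->
  velv r1 = k -> pres r1 = - (k * m) -> velv r4 = k -> pres r4 = k * m ->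
  exists B : 'rV[R]_4 -> 'rV[R]_4, [/\ blin B,
    forall h, B (velu h *: g + velv h *: vec4 u 0 0 0 + pres h *: vec4 0 0 0 rho +
                 dens h *: r4) = h,
    forall w, B w = 0 -> w = 0
  & `|dens (B r1)| < 1].
Proof.
move=> u0 rho0 k0 m0 vg pg v1 p1 v4 p4.
have D0 : 0 < m * velv g - pres g by rewrite subr_gt0 (lt_trans pg) // mulr_gt0.
have [k1 D1] : k != 0 /\ m * velv g - pres g != 0 by rewrite !gt_eqF.
(* Cramer's rule in the components [velv] and [pres], which involve only [g] and [r4]; the other two
   strengths are then read off [velu] and [dens]. *)
pose a w := (m * velv w - pres w) / (m * velv g - pres g).
pose d w := (velv g * pres w - pres g * velv w) / (k * (m * velv g - pres g)).
pose B w := vec4 (a w) ((velu w - a w * velu g - d w * velu r4) / u)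
  ((dens w - a w * dens g - d w * dens r4) / rho) (d w).
exists B; split.
- apply: blin_rV => c w w'; apply: stateP; rewrite /B /a /d !stateE; field;
    by rewrite ?u0 ?rho0 ?k1 ?D1.
- move=> h; apply: stateP; rewrite /B /a /d !stateE v4 p4; field;
    by rewrite ?u0 ?rho0 ?k1 ?D1.
- move=> w Bw.
  have a0 : a w = 0 by have := congr1 velu Bw; rewrite !stateE.
  have d0 : d w = 0 by have := congr1 dens Bw; rewrite !stateE.
  have := congr1 velv Bw; have := congr1 pres Bw; rewrite /B a0 d0 !stateE !mul0r !subr0.
  move=> /eqP; rewrite mulf_eq0 invr_eq0 (negbTE rho0) orbF => /eqP rw.
  move=> /eqP; rewrite mulf_eq0 invr_eq0 (negbTE u0) orbF => /eqP uw.
  move/eqP: a0; rewrite mulf_eq0 invr_eq0 (negbTE D1) orbF subr_eq0 => /eqP pw.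
  move/eqP: d0; rewrite mulf_eq0 invr_eq0 mulf_eq0 (negbTE D1) (negbTE k1) !orbF -pw.
  rewrite mulrA [velv g * m]mulrC -mulrBl mulf_eq0 (negbTE D1) /= => /eqP vw.
  by apply: stateP; rewrite !stateE // -pw vw mulr0.
- rewrite /B !stateE /d v1 p1.
  have -> : (velv g * - (k * m) - pres g * k) / (k * (m * velv g - pres g)) =
      - ((m * velv g + pres g) / (m * velv g - pres g)) by field; rewrite k1 D1.
  rewrite normrN normrM normfV (gtr0_norm D0) ltr_pdivrMr // mul1r ltr_norml.
  have mv : 0 < m * velv g by rewrite mulr_gt0.
  by apply/andP; split; lra.
Qed.

End WaveMaps.

(** * Coordinatewise norm bounds and the abstract interaction estimate *)

Lemma mx_norm_lt (R : realType) n (v : 'rV[R]_n) (e : R) :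
  0 < e -> (forall i, `|v 0 i| < e) -> `|v| < e.
Proof.
move=> e0 ve; rewrite [ltLHS]/Num.Def.normr /= mx_normrE.
by apply: bigmax_lt => // -[i j] _ /=; rewrite (ord1 i).
Qed.

Lemma vec4_norm_lt (R : realType) (U : 'rV[R]_4) (e : R) : 0 < e ->
  `|velu U| < e -> `|velv U| < e -> `|pres U| < e -> `|dens U| < e -> `|U| < e.
Proof. by move=> e0 *; apply: mx_norm_lt => //; exact: ord4P. Qed.

Lemma vec4_norm_le (R : realType) (U : 'rV[R]_4) (e : R) : 0 <= e ->
  `|velu U| <= e -> `|velv U| <= e -> `|pres U| <= e -> `|dens U| <= e -> `|U| <= e.
Proof. by move=> e0 *; apply: mx_norm_le => //; exact: ord4P. Qed.

Lemma coord_norm (R : realType) (U : 'rV[R]_4) :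
  [/\ `|velu U| <= `|U|, `|velv U| <= `|U|, `|pres U| <= `|U| & `|dens U| <= `|U|].
Proof. by split; exact: mx_norm_coord. Qed.

(* Wave strengths are packed in a row vector [z] and read off with the
   accessors of states: [velu z] is the speed [sigma1] (or the strength [beta1])
   and [velv z], [pres z], [dens z] are the strengths of the 2-, 3- and 4-waves.
   [F (z, U)] is the state above [U] across the waves [z]. *)
Section Interaction.
Context {R : realType}.
Local Notation vec := 'rV[R]_4.
Variables (F Psi : vec * vec -> vec) (z0 Ub Um1 r1 r2 r3 : vec).
Variables (B : vec -> vec) (LF : vec * vec -> vec).
Hypothesis z0_dens : dens z0 = 0.
Hypothesis F0 : F (z0, Ub) = Um1.
Hypothesis F_diff : strict_diff F (z0, Ub) LF.
Hypothesis B_blin : blin B.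
Hypothesis BLF : forall h, B (LF (h, 0)) = h.
Hypothesis B_inj : forall w, B w = 0 -> w = 0.
Hypothesis Br1 : `|dens (B r1)| < 1.
Hypothesis Psi_diff : strict_diff Psi (0, Um1)
  (fun h => velu h.1 *: r1 + velv h.1 *: r2 + pres h.1 *: r3 + h.2).
Hypothesis Psi0 : exists2 d : R, 0 < d & forall V, `|V - Um1| < d -> Psi (0, V) = V.
(** With no 4-wave in [z] and no 1-wave in [b], only contact waves meet, and these combine
    exactly. *)
Hypothesis PsiF : exists2 d : R, 0 < d & forall z U b,
  `|z - z0| < d -> `|U - Ub| < d -> `|b| < d ->
  velu b = 0 -> dens b = 0 -> dens z = 0 -> Psi (b, F (z, U)) = F (z + b, U).
Hypothesis Psi_mixed : exists2 k : R, 0 < k & exists2 d : R, 0 < d &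
  forall b V W, `|b| < d -> `|V - Um1| < d -> `|W - Um1| < d ->
    `|Psi (b, V) - V - (Psi (b, W) - W)| <= k * `|b| * `|V - W|.
Hypothesis F_mixed : exists2 k : R, 0 < k & exists2 d : R, 0 < d &
  forall z e t U, `|z - z0| < d -> `|e| < d -> `|t| < d -> `|U - Ub| < d ->
    dens z = 0 -> let z' := z + vec4 0 0 0 t in
    `|F (z' + e, U) - F (z', U) - (F (z + e, U) - F (z, U))| <= k * `|t| * `|e|.

(* Let [zo] be [z] without its 4-wave and [y] the strengths of the waves that
   result from [zo] and [b]; [K] is defined by [y = zo + b' + velu b *: K].  The
   mixed differences [Psi_mixed] and [F_mixed] control the effect of putting the
   4-wave back. *)
Lemma interaction_estimate : exists r C : R, [/\ 0 < r, 0 < C &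
  forall U z b z', `|U - Ub| < r -> `|z - z0| < r -> `|b| < r -> `|z' - z0| < r ->
    dens b = 0 -> F (z', U) = Psi (b, F (z, U)) ->
  exists K : vec, [/\ `|K| <= C, `|dens K| < 1
    & `|z' - (z + vec4 0 (velv b) (pres b) 0 + velu b *: K)| <=
       C * `|dens z| * `|b|]].
Proof.
have [rI [C1 [rI0 C10 F_injective F_surjective]]] := strict_inverse F_diff B_blin BLF B_inj.
have [kF kF0 [dF dF0 F_lip]] := strict_diff_lip F_diff.
have [kP kP0 [dP dP0 P_lip]] := strict_diff_lip Psi_diff.
have [dP0' dP0'0 HP0] := Psi0.
have [dPF dPF0 HPF] := PsiF.
have [k4 k40 [d4 d40 H4]] := Psi_mixed.
have [k5 k50 [d5 d50 H5]] := F_mixed.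
have [_ [kB kB0 B_le]] := B_blin.
(* The margin below 1. Linearizing [F] and linearizing [Psi] may each cost [gap / 4]: the first
   tolerance offsets [|y - w| <= C1 * kP * |velu b|], the second the bound [kB] of [B]. *)
pose gap := 1 - `|dens (B r1)|.
have gap0 : 0 < gap by rewrite subr_gt0.
have th0 : 0 < gap / (4 * C1 * kP) by rewrite divr_gt0 ?mulr_gt0.
have e0 : 0 < gap / (4 * (1 + kB)) by rewrite divr_gt0 ?mulr_gt0 // ltr_pwDl.
have [dB dB0 HB] := strict_inverse_approx F_diff B_blin BLF th0.
have [dQ dQ0 HQ] := Psi_diff.2 _ e0.
pose rr := Num.min rI (Num.min dF (Num.min dPF (Num.min d4 (Num.min d5 (Num.min dB
  (Num.min dQ (Num.min dP dP0'))))))).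
have rr0 : 0 < rr by rewrite !lt_min rI0 dF0 dPF0 d40 d50 dB0 dQ0 dP0 dP0'0.
have rrP (x : R) : x < rr -> [/\ x < rI, x < dF, x < dPF & x < d4] /\
    [/\ x < d5, x < dB, x < dQ, x < dP & x < dP0'].
  rewrite !lt_min; case/andP => -> /andP[-> /andP[-> /andP[-> /andP[-> /andP[->]]]]].
  by case/andP => -> /andP[-> ->].
clearbody rr.
(* Thirds, because [z + e - z0] will be a sum of three displacements: those of [z], [y] and [zo]
   from [z0]. *)
have rr3 : 0 < rr / 3 by rewrite divr_gt0.
have rr3' : rr / 3 < rr by rewrite ltr_pdivrMr // ltr_pMr // ltr1n.
have [ey ey0 Hy] := F_surjective _ rr3.
have [dV dV0 HV] := strict_diff_near Psi_diff ey0.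
have dXV0 : 0 < Num.min rr dV by rewrite lt_min rr0.
have [dX dX0 HX] := strict_diff_near F_diff dXV0.
pose r := Num.min (rr / 3) (Num.min dX (Num.min dV ey)).
(* The first summand bounds [K]. In the second, [C1] converts errors of states into errors of
   strengths, [kF] measures the 4-wave's effect on the state, and [C1 * kP] the size of [e] relative
   to [b]. *)
pose C := C1 * kP + C1 * (k4 * kF + k5 * (C1 * kP)).
have CK : C1 * kP <= C by rewrite lerDl !(mulr_ge0, addr_ge0) // ltW.
have rP (x : R) : x < r -> [/\ x < rr / 3, x < dX, x < dV, x < ey & x < rr].
  rewrite !lt_min => /and4P[x1 -> -> ->]; split=> //.
  exact: lt_trans x1 rr3'.
have r0 : 0 < r by rewrite !lt_min rr3 dX0 dV0.
clearbody r; exists r, C; split=> //.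
- by rewrite addr_gt0 ?mulr_gt0 ?addr_gt0 ?mulr_gt0.
move=> U z b z' /rP[Ur3 UdX UdV Uey Urr] /rP[zr3 zdX zdV _ zrr] /rP[br3 bdX bdV _ brr].
move=> /rP[z'r3 _ _ _ z'rr] bd Fz'.
have pair_near (x y : vec) (d : R) x0 y0 : `|x - x0| < d -> `|y - y0| < d ->
    `|(x, y) - (x0, y0)| < d by move=> xd yd; rewrite prod_normE gt_max xd.
pose zo := vec4 (velu z) (velv z) (pres z) 0.
have zoE : z = zo + vec4 0 0 0 (dens z) by apply: stateP; rewrite !stateE; ring.
have zo_le : `|zo - z0| <= `|z - z0|.
  have [n1 n2 n3 _] := coord_norm (z - z0); move: n1 n2 n3; rewrite !stateE => n1 n2 n3.
  by apply: vec4_norm_le => //; rewrite !stateE // z0_dens subrr normr0.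
have dens_le : `|dens z| <= `|z - z0|.
  by have [_ _ _] := coord_norm (z - z0); rewrite !stateE z0_dens subr0.
have zo3 := le_lt_trans zo_le zr3; have zoX := le_lt_trans zo_le zdX.
have zorr := le_lt_trans zo_le zrr.
pose X := F (zo, U); pose V := Psi (b, X).
have : `|X - Um1| < Num.min rr dV by rewrite -F0; apply: HX; exact: pair_near.
rewrite lt_min => /andP[Xrr XdV].
have : `|F (z, U) - Um1| < Num.min rr dV by rewrite -F0; apply: HX; exact: pair_near.
rewrite lt_min => /andP[Zrr ZdV].
have PUm : Psi (0, Um1) = Um1 by apply: HP0; rewrite subrr normr0.
have Vey : `|V - F (z0, Ub)| < ey.
  by rewrite F0 -{1}PUm; apply: HV; apply: pair_near; rewrite ?subr0.
have [y y3 Fy] := Hy U V Uey Vey.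
pose b' := vec4 0 (velv b) (pres b) 0.
have b'_le : `|b'| <= `|b|.
  have [n1 n2 n3 _] := coord_norm b.
  by apply: vec4_norm_le => //; rewrite !stateE // normr0.
have b'3 := le_lt_trans b'_le br3; have b'rr := le_lt_trans b'_le brr.
have [[Ui UF UPF U4] [U5 UB UQ UP UP0]] := rrP _ Urr.
have [[zoi zoF zoPF zo4] [zo5 zoB zoQ zoP zoP0]] := rrP _ zorr.
have [[zi zF zPF z4] _] := rrP _ zrr.
have [[bi bF bPF b4] [b5 bB bQ bP bP0]] := rrP _ brr.
have [[b'i b'F b'PF b'4] [b'5 b'B b'Q b'P b'P0]] := rrP _ b'rr.
have [[Xi XF XPF X4] [X5 XB XQ XP XP0]] := rrP _ Xrr.
have [[_ _ _ Z4] _] := rrP _ Zrr.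
have split3 : rr = rr / 3 + rr / 3 + rr / 3 by field.
have yrr : `|y - z0| < rr.
  exact: lt_trans y3 rr3'.
have [[yi yF _ _] [_ yB _ _ _]] := rrP _ yrr.
(* The outcome if the 1-wave of [b] were missing too, known exactly by [PsiF]; hence [y - w] is due
   to [velu b] alone. *)
pose w := zo + b'.
have wrr : `|w - z0| < rr.
  rewrite /w addrAC (le_lt_trans (ler_normD _ _)) // split3 ltr_wpDr ?(ltW rr3) //.
  exact: ltrD.
have [[wi _ _ _] [_ wB _ _ _]] := rrP _ wrr.
have Fw : F (w, U) = Psi (b', X) by rewrite HPF // !stateE.
have bb' : b - b' = vec4 (velu b) 0 0 0.
  by apply: stateP; rewrite !stateE ?bd; ring.
have bb'_le : `|b - b'| <= `|velu b|.
  by rewrite bb'; apply: vec4_norm_le => //; rewrite !stateE // normr0.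
have pairB (p q x : vec) : (p, x) - (q, x) = (p - q, 0).
  by congr (_, _); rewrite /= subrr.
have norm0 (p : vec) : `|(p, 0 : vec)| = `|p|.
  by rewrite prod_normE /= normr0 max_l.
have FyFw : `|V - Psi (b', X)| <= kP * `|velu b|.
  have := P_lip (b, X) (b', X); rewrite pairB norm0 => H.
  rewrite (le_trans (H _ _)) ?ler_wpM2l ?(ltW kP0) //; apply: pair_near => //.
    by rewrite subr0.
  by rewrite subr0.
have yw : `|y - w| <= C1 * (kP * `|velu b|).
  by rewrite (le_trans (F_injective y w U yi wi Ui)) // Fy Fw ler_wpM2l // ltW.
have near1 : `|y - w - B (V - Psi (b', X))| <= gap / 4 * `|velu b|.
  have := HB y w U yB wB UB; rewrite Fy Fw => /le_trans; apply.
  rewrite (le_trans (ler_wpM2l (ltW th0) yw)) //.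
  by rewrite le_eqVlt; apply/orP; left; apply/eqP; field; rewrite !gt_eqF.
have near2 : `|B (V - Psi (b', X)) - velu b *: B r1| <= gap / 4 * `|velu b|.
  rewrite -(blinZ B_blin) -(blinB B_blin) (le_trans (B_le _)) //.
  have := HQ (b, X) (b', X); rewrite pairB norm0 bb' !stateE !scale0r !addr0 => H.
  have {H} H : `|V - Psi (b', X) - velu b *: r1| <= gap / (4 * (1 + kB)) * `|velu b|.
    rewrite -bb' in H.
    apply: le_trans (H _ _) _; [| |by rewrite ler_wpM2l // ltW];
      by apply: pair_near; rewrite ?subr0.
  rewrite (le_trans (ler_wpM2l kB0 H)) // mulrA ler_wpM2r //.
  have -> : kB * (gap / (4 * (1 + kB))) = gap / 4 * (kB / (1 + kB)).
    by field; rewrite gt_eqF // ltr_pwDl.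
  rewrite -[leRHS]mulr1 ler_wpM2l ?divr_ge0 ?(ltW gap0) //.
  by rewrite ler_pdivrMr ?ltr_pwDl // mul1r lerDr.
have near3 : `|y - w - velu b *: B r1| <= gap / 2 * `|velu b|.
  rewrite -(subrK (B (V - Psi (b', X))) (y - w)) -addrA.
  rewrite (le_trans (ler_normD _ _)) // (le_trans (lerD near1 near2)) //.
  by rewrite le_eqVlt; apply/orP; left; apply/eqP; field.
(* When [velu b = 0] the bound [yw] forces [y = w], so the default 0 still satisfies [KE]. *)
pose K : vec := if velu b == 0 then 0 else (velu b)^-1 *: (y - w).
have KE : velu b *: K = y - w.
  rewrite /K; case: eqP => [b0|/eqP b0]; last by rewrite scalerA mulfV // scale1r.
  apply/esym/eqP; rewrite scaler0 -normr_le0 (le_trans yw) //.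
  by rewrite b0 normr0 !mulr0.
exists K; split.
- apply: le_trans CK; rewrite /K; case: eqP => [_|/eqP b0].
    by rewrite normr0 mulr_ge0 // ltW.
  rewrite normrZ normfV ler_pdivrMl ?normr_gt0 // (le_trans yw) //.
  by rewrite mulrA mulrC.
- rewrite /K; case: eqP => [_|/eqP b0]; first by rewrite !stateE normr0.
  have bp : 0 < `|velu b| by rewrite normr_gt0.
  have h : `|dens ((velu b)^-1 *: (y - w)) - dens (B r1)| <= gap / 2.
    rewrite -(ler_pM2r bp) (le_trans _ near3) //.
    have [_ _ _] := coord_norm (y - w - velu b *: B r1).
    apply: le_trans; rewrite mulrC -normrM mulrBr !stateE mulrA mulfV // mul1r.
    by rewrite lexx.
  rewrite -(subrK (dens (B r1)) (dens _)) (le_lt_trans (ler_normD _ _)) //.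
  rewrite (le_lt_trans (lerD h (lexx _))) // -ltrBrDr -/gap.
  by rewrite ltr_pdivrMr // ltr_pMr // ltr1n.
have -> : z' - (z + vec4 0 (velv b) (pres b) 0 + velu b *: K) = z' - (z + (y - zo)).
  have aux (p q x : vec) : p + q + (y - (x + q)) = p + (y - x).
    by apply: stateP; rewrite !stateE; ring.
  by rewrite KE aux.
(* [e] is the change of strengths caused by [b] without the 4-wave; what remains is that the same
   change nearly works with the 4-wave, that is, [z'] is close to [z + e]. *)
set e := y - zo.
have e3 : `|e| < rr / 3 + rr / 3.
  rewrite /e -(subrK z0 y) -addrA (le_lt_trans (ler_normD _ _)) // ltrD //.
  by rewrite distrC.
have err : `|e| < rr by rewrite split3 (lt_le_trans e3) // lerDl ltW.
have [_ [e5 _ _ _ _]] := rrP _ err.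
have zerr : `|z + e - z0| < rr.
  have h := ltrD zr3 e3; rewrite addrA -split3 in h.
  by rewrite addrAC; exact: le_lt_trans (ler_normD _ _) h.
have [[zei _ _ _] _] := rrP _ zerr.
have [[z'i _ _ _] _] := rrP _ z'rr.
rewrite (le_trans (F_injective z' (z + e) U z'i zei Ui)) // Fz'.
have zoeE : zo + e = y by rewrite /e addrC subrK.
have dens5 : `|dens z| < d5.
  by have [_ [d5' _ _ _ _]] := rrP _ (le_lt_trans dens_le zrr).
have H5' := H5 zo e (dens z) U zo5 e5 dens5 U5.
have {}H5' : `|F (z + e, U) - F (z, U) - (V - X)| <= k5 * `|dens z| * `|e|.
  have zo0 : dens zo = 0 by rewrite stateE.
  by move: (H5' zo0); cbv zeta; rewrite -zoE zoeE Fy.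
have H4' := H4 b (F (z, U)) X b4 Z4 X4.
have FzX : `|F (z, U) - X| <= kF * `|dens z|.
  have := F_lip (z, U) (zo, U); rewrite pairB norm0 => H.
  rewrite (le_trans (H _ _)) ?ler_wpM2l ?(ltW kF0) //; try exact: pair_near.
  rewrite [in z - zo]zoE addrAC subrr add0r.
  by apply: vec4_norm_le => //; rewrite !stateE // normr0.
have e_le : `|e| <= C1 * (kP * `|b|).
  rewrite /e (le_trans (F_injective y zo U yi zoi Ui)) // Fy ler_wpM2l ?(ltW C10) //.
  rewrite -/X -{1}(HP0 X XP0).
  have := P_lip (b, X) (0, X); rewrite pairB norm0 subr0 => H.
  by apply: H; apply: pair_near; rewrite ?subr0 ?normr0.
(* The increment [V - X] equals both [Psi (b, X) - X] and [F (zo + e, U) - F (zo, U)]. Subtracting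
   it twice leaves two mixed differences, each pairing the 4-wave with [b] or [e]. *)
have -> : Psi (b, F (z, U)) - F (z + e, U) =
    (Psi (b, F (z, U)) - F (z, U) - (V - X)) - (F (z + e, U) - F (z, U) - (V - X)).
  have aux (p q x v : vec) : p - x = (p - q - v) - (x - q - v).
    by apply: stateP; rewrite !stateE; ring.
  exact: aux.
rewrite (le_trans (ler_wpM2l (ltW C10) (ler_normB _ _))) //.
rewrite (le_trans (ler_wpM2l (ltW C10) (lerD H4' H5'))) //.
have l1 : k4 * `|b| * `|F (z, U) - X| <= k4 * kF * (`|dens z| * `|b|).
  rewrite (le_trans (ler_wpM2l _ FzX)) ?mulr_ge0 ?(ltW k40) //.
  by rewrite le_eqVlt; apply/orP; left; apply/eqP; ring.
have l2 : k5 * `|dens z| * `|e| <= k5 * (C1 * kP) * (`|dens z| * `|b|).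
  rewrite (le_trans (ler_wpM2l _ e_le)) ?mulr_ge0 ?(ltW k50) //.
  by rewrite le_eqVlt; apply/orP; left; apply/eqP; ring.
rewrite (le_trans (ler_wpM2l (ltW C10) (lerD l1 l2))) // -mulrDl mulrA -[leRHS]mulrA.
by rewrite ler_wpM2r ?mulr_ge0 // lerDr mulr_ge0 // ltW.
Qed.

End Interaction.

(** * The Euler wave maps meet the hypotheses of the abstract estimate *)

Section Waves.
Context {R : realType}.
Local Notation vec := 'rV[R]_4.
Variables (gamma : R) (Phi1 Phi4 : R -> vec -> vec) (Ub Um1 : vec) (sigma10 : R).
Hypothesis gamma_gt1 : 1 < gamma.
Hypothesis Phi1_lax : lax_parametrization gamma 1 Phi1.
Hypothesis Phi4_lax : lax_parametrization gamma 4 Phi4.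
Hypothesis Um1_supersonic : supersonic gamma Um1.
Hypothesis Um1_horizontal : velv Um1 = 0.
Hypothesis strong_shock : shock gamma 1 sigma10 Ub Um1.

(** The concrete [F], in which the zero-strength 1-wave of [Phi] is left out; likewise [above_weak],
    the concrete [Psi], leaves out the zero-strength 4-wave. Both omissions are justified near
    [Um1], where these maps are the identity. *)
Definition above_strong (x : vec * vec) : vec :=
  Phi4 (dens x.1) (contact (velv x.1) (pres x.1) (shock_state gamma (velu x.1) x.2)).

Definition above_weak (x : vec * vec) : vec :=
  contact (velv x.1) (pres x.1) (Phi1 (velu x.1) x.2).

Let z0 : vec := vec4 sigma10 0 0 0.
Let r2 : vec := vec4 (velu Um1) 0 0 0.
Let r3 : vec := vec4 0 0 0 (dens Um1).
Let r1 := eigvec gamma 1 Um1.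
Let r4 := eigvec gamma 4 Um1.

Lemma Um1E : shock_state gamma sigma10 Ub = Um1.
Proof. by rewrite -(shock1_stateE gamma_gt1 strong_shock). Qed.

Lemma strong_shock_state : shock gamma 1 sigma10 Ub (shock_state gamma sigma10 Ub).
Proof. by rewrite Um1E. Qed.

Lemma shock_state_diff : exists LG, [/\
   strict_diff (fun x : R^o * vec => shock_state gamma x.1 x.2) (sigma10, Ub) LG,
   0 < velv (LG (1, 0)) & pres (LG (1, 0)) < 0].
Proof.
have sh := strong_shock_state.
have [N0 N'0] := shock1_cross_gt0 sh; have [[[_ r0 _] _] _ _ _ _] := sh.
have [a [b [LG sG LGE]]] := shock_state_sdiff gamma_gt1 (lt0r_neq0 r0)
  (lt0r_neq0 N0) (lt0r_neq0 N'0).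
have vh : velv (shock_state gamma sigma10 Ub) = 0 by rewrite Um1E.
have [v0 p0] := shock_rates gamma_gt1 sh vh.
by exists LG; rewrite LGE !stateE.
Qed.

Lemma above_contact_diff LG :
  strict_diff (fun x : R^o * vec => shock_state gamma x.1 x.2) (sigma10, Ub) LG ->
  strict_diff (fun x : vec * vec =>
      contact (velv x.1) (pres x.1) (shock_state gamma (velu x.1) x.2)) (z0, Ub)
    (fun h => velv h.1 *: r2 + pres h.1 *: r3 + LG (velu h.1, h.2)).
Proof.
move=> sG.
have lin (f : vec -> R^o) : blin f -> strict_diff (fun x : vec * vec => f x.1) (z0, Ub)
    (fun h => f h.1).
  by move=> fb; apply: strict_diff_blin; exact: (blin_comp (blin_fst _ _) fb).
have h1 := strict_diff_pair (lin _ blin_velu) (strict_diff_blin (z0, Ub) (blin_snd vec vec)).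
have x1E : (velu (z0, Ub).1, (z0, Ub).2) = (sigma10, Ub) by rewrite /= /z0 stateE.
have h2 := strict_diff_comp x1E h1 sG.
have h3 := strict_diff_pair (strict_diff_pair (lin _ blin_velv) (lin _ blin_pres)) h2.
have x2E : (velv (z0, Ub).1, pres (z0, Ub).1,
    shock_state gamma (velu (z0, Ub).1) (z0, Ub).2) = ((0, 0), Um1).
  by rewrite /= /z0 !stateE Um1E.
have h4 := strict_diff_comp x2E h3 (strict_diff_contact Um1).
by apply: strict_diff_eq h4 (frefl _) _ => h; rewrite Um1_horizontal.
Qed.

Lemma above_strong_diff LG :
  strict_diff (fun x : R^o * vec => shock_state gamma x.1 x.2) (sigma10, Ub) LG ->
  strict_diff above_strong (z0, Ub)
    (fun h => dens h.1 *: r4 + (velv h.1 *: r2 + pres h.1 *: r3 + LG (velu h.1, h.2))).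
Proof.
move=> sG; have hc := above_contact_diff sG.
have hd : strict_diff (fun x : vec * vec => dens x.1 : R^o) (z0, Ub) (fun h => dens h.1).
  by apply: strict_diff_blin; exact: (blin_comp (blin_fst _ _) blin_dens).
have [h4 _ _] := lax_strict_diff Phi4_lax Um1_supersonic.
apply: (strict_diff_comp _ (strict_diff_pair hd hc) h4).
by rewrite /= /z0 !stateE Um1E contact0.
Qed.

Lemma above_weak_diff : strict_diff above_weak (0, Um1)
  (fun h => velu h.1 *: r1 + velv h.1 *: r2 + pres h.1 *: r3 + h.2).
Proof.
have lin (f : vec -> R^o) : blin f -> strict_diff (fun x : vec * vec => f x.1) (0, Um1)
    (fun h => f h.1).
  by move=> fb; apply: strict_diff_blin; exact: (blin_comp (blin_fst _ _) fb).
have [h1 [d d0 Phi10] _] := lax_strict_diff Phi1_lax Um1_supersonic.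
have h2 := strict_diff_pair (lin _ blin_velu) (strict_diff_blin (0, Um1) (blin_snd vec vec)).
have x1E : (velu (0 : vec, Um1).1, (0 : vec, Um1).2) = (0, Um1) by rewrite /= state0.
have h3 := strict_diff_comp x1E h2 h1.
have h4 := strict_diff_pair (strict_diff_pair (lin _ blin_velv) (lin _ blin_pres)) h3.
have x2E : (velv (0 : vec, Um1).1, pres (0 : vec, Um1).1,
    Phi1 (velu (0 : vec, Um1).1) (0 : vec, Um1).2) = ((0, 0), Um1).
  by rewrite /= !state0 Phi10 // subrr normr0.
have h5 := strict_diff_comp x2E h4 (strict_diff_contact Um1).
apply: strict_diff_eq h5 (frefl _) _ => h.
rewrite Um1_horizontal -/r1 -/r2 -/r3 /=; move: r1 r2 r3 => r1' r2' r3'.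
by apply: stateP; rewrite !stateE; ring.
Qed.

Lemma above_strong0 : above_strong (z0, Ub) = Um1.
Proof.
have [_ [d d0 Phi40] _] := lax_strict_diff Phi4_lax Um1_supersonic.
by rewrite /above_strong /= /z0 !stateE Um1E contact0 Phi40 // subrr normr0.
Qed.

Lemma above_weak0 : exists2 d : R, 0 < d & forall V, `|V - Um1| < d -> above_weak (0, V) = V.
Proof.
have [_ [d d0 Phi10] _] := lax_strict_diff Phi1_lax Um1_supersonic.
by exists d => // V Vd; rewrite /above_weak /= !stateE Phi10 // contact0.
Qed.

Lemma above_weak_strong : exists2 d : R, 0 < d & forall z U b,
  `|z - z0| < d -> `|U - Ub| < d -> `|b| < d ->
  velu b = 0 -> dens b = 0 -> dens z = 0 ->
  above_weak (b, above_strong (z, U)) = above_strong (z + b, U).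
Proof.
have [LG [sG _ _]] := shock_state_diff.
have [_ [d1 d10 Phi10] _] := lax_strict_diff Phi1_lax Um1_supersonic.
have [_ [d4 d40 Phi40] _] := lax_strict_diff Phi4_lax Um1_supersonic.
have d0 : 0 < Num.min d1 d4 by rewrite lt_min d10.
have [d2 d20 H] := strict_diff_near (above_contact_diff sG) d0.
exists (d2 / 2) => [|z U b zd Ud bd b0 bd0 zd0]; first by rewrite divr_gt0.
have half : d2 / 2 < d2 by rewrite ltr_pdivrMr // ltr_pMr // ltr1n.
have H1 w : `|w - z0| < d2 ->
   `|contact (velv w) (pres w) (shock_state gamma (velu w) U) - Um1| < Num.min d1 d4.
  move=> wd; have := H (w, U); rewrite /= /z0 !stateE Um1E contact0; apply.
  by rewrite prod_normE /= gt_max wd (lt_trans Ud).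
have := H1 z (lt_trans zd half); rewrite lt_min => /andP[z1 z4].
have zbd : `|z + b - z0| < d2.
  by rewrite addrAC (le_lt_trans (ler_normD _ _)) // (splitr d2) ltrD.
have := H1 _ zbd; rewrite lt_min => /andP[_ zb4].
rewrite /above_weak /above_strong /= !stateE b0 bd0 zd0 !addr0 in zb4 *.
rewrite !Phi40 ?Phi10 // ?contactD //.
Qed.

Lemma above_weak_mixed : exists2 k : R, 0 < k & exists2 d : R, 0 < d &
  forall b V W, `|b| < d -> `|V - Um1| < d -> `|W - Um1| < d ->
    `|above_weak (b, V) - V - (above_weak (b, W) - W)| <= k * `|b| * `|V - W|.
Proof.
have [h1 [d1 d10 Phi10] [k1 k10 [d2 d20 H1]]] := lax_strict_diff Phi1_lax Um1_supersonic.
have [k3 k30 [d3 d30 H3]] := contact_mixed (R := R).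
have [k4 k40 [d4 d40 H4]] := strict_diff_lip h1.
exists (k3 * k4 + k1); first by rewrite addr_gt0 ?mulr_gt0.
exists (Num.min (Num.min d1 d2) (Num.min d3 d4)); first by rewrite !lt_min d10 d20 d30.
move=> b V W; rewrite !lt_min => /andP[/andP[b1 b2] /andP[b3 b4]].
move=> /andP[/andP[V1 V2] /andP[V3 V4]] /andP[/andP[W1 W2] /andP[W3 W4]].
have [bu bv bp _] := coord_norm b.
set P := Phi1 (velu b).
have PVW : `|P V - P W| <= k4 * `|V - W|.
  have dE : ((velu b, V) : R^o * vec) - (velu b, W) = (0, V - W).
    by congr (_, _); exact: subrr.
  have nb A : `|A - Um1| < d4 -> `|((velu b, A) : R^o * vec) - (0, Um1)| < d4.
    by move=> Ad; rewrite prod_normE /= gt_max subr0 (le_lt_trans bu b4).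
  have := H4 _ _ (nb _ V4) (nb _ W4); rewrite dE prod_normE /= normr0 max_r //.
have PP : `|P V - V - (P W - W)| <= k1 * `|b| * `|V - W|.
  (* The C2 estimate started from parameter 0, where [Phi1] is the identity. *)
  have := H1 0 0 (velu b) V W; rewrite normr0 !add0r oppr0 normr0 !Phi10 // => H.
  rewrite (le_trans (H _ _ _ _ _)) // ?(le_lt_trans bu b2) // max_r //.
  by rewrite ler_wpM2r // ler_wpM2l // ltW.
have CC : `|contact (velv b) (pres b) (P V) - P V -
    (contact (velv b) (pres b) (P W) - P W)| <= k3 * `|b| * (k4 * `|V - W|).
  rewrite (le_trans (H3 _ _ _ _ (le_lt_trans bv b3) (le_lt_trans bp b3))) //.
  apply: ler_pM => //; first by rewrite mulr_ge0 ?(ltW k30) // le_max normr_ge0.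
  by rewrite ler_wpM2l ?(ltW k30) // ge_max bv.
have -> : above_weak (b, V) - V - (above_weak (b, W) - W) =
    (contact (velv b) (pres b) (P V) - P V - (contact (velv b) (pres b) (P W) - P W)) +
    (P V - V - (P W - W)).
  have aux (p q x p' q' x' : vec) : p - x - (p' - x') =
      (p - q - (p' - q')) + (q - x - (q' - x')).
    by apply: stateP; rewrite !stateE; ring.
  exact: aux.
rewrite (le_trans (ler_normD _ _)) // (le_trans (lerD CC PP)) //.
by rewrite le_eqVlt; apply/orP; left; apply/eqP; ring.
Qed.

(** The strength [t] enters only through the parameter of [Phi4]. This is therefore the mixed
    difference of [Phi4] between the base points [(dens e, X (z + e))] and [(0, X z)], whose
    distance is of order [|e|]. *)
Lemma above_strong_mixed : exists2 k : R, 0 < k & exists2 d : R, 0 < d &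
  forall z e t U, `|z - z0| < d -> `|e| < d -> `|t| < d -> `|U - Ub| < d ->
    dens z = 0 -> let z' := z + vec4 0 0 0 t in
    `|above_strong (z' + e, U) - above_strong (z', U) -
      (above_strong (z + e, U) - above_strong (z, U))| <= k * `|t| * `|e|.
Proof.
have [LG [sG _ _]] := shock_state_diff; have hc := above_contact_diff sG.
have [_ _ [k1 k10 [d1 d10 H1]]] := lax_strict_diff Phi4_lax Um1_supersonic.
have [k2 k20 [d2 d20 H2]] := strict_diff_lip hc.
have [d3 d30 H3] := strict_diff_near hc d10.
pose d := Num.min d1 (Num.min d2 d3).
have d0 : 0 < d by rewrite !lt_min d10 d20.
exists (k1 * (1 + k2)); first by rewrite mulr_gt0 // addr_gt0.
exists (d / 2) => [|z e t U zd ed td Ud zd0]; first by rewrite divr_gt0.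
cbv zeta; set z' := z + _.
have half : d / 2 < d by rewrite ltr_pdivrMr // ltr_pMr // ltr1n.
have zed : `|z + e - z0| < d.
  by rewrite addrAC (le_lt_trans (ler_normD _ _)) // (splitr d) ltrD.
have := lt_trans zd half; have := lt_trans ed half; have := lt_trans td half.
have := lt_trans Ud half; move: zed.
rewrite !lt_min => /and3P[ze1 ze2 ze3] /and3P[U1 U2 U3] /and3P[t1 t2 t3].
move=> /and3P[e1 e2 e3] /and3P[z1 z2 z3].
pose X w := contact (velv w) (pres w) (shock_state gamma (velu w) U).
have X0 : contact (velv z0) (pres z0) (shock_state gamma (velu z0) Ub) = Um1.
  by rewrite /z0 !stateE Um1E contact0.
have XU w : `|w - z0| < d3 -> `|X w - Um1| < d1.
  by move=> wd; have := H3 (w, U); rewrite /= X0; apply; rewrite prod_normE /= gt_max wd.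
have XX : `|X (z + e) - X z| <= k2 * `|e|.
  have := H2 (z + e, U) (z, U).
  rewrite !prod_normE /= !gt_max ze2 z2 U2 => /(_ isT isT).
  by rewrite subrr normr0 max_l // [z + e - z]addrAC subrr add0r.
have [_ _ _ ne] := coord_norm e.
have := H1 (dens e) 0 t (X (z + e)) (X z) (le_lt_trans ne e1) _ t1 (XU _ ze3) (XU _ z3).
rewrite normr0 => /(_ d10) H.
have E1 : above_strong (z' + e, U) = Phi4 (dens e + t) (X (z + e)).
  by rewrite /above_strong /X /z' /= !stateE zd0 !addr0 add0r [t + _]addrC.
have E2 : above_strong (z', U) = Phi4 (0 + t) (X z).
  by rewrite /above_strong /X /z' /= !stateE zd0 !addr0.
have E3 : above_strong (z + e, U) = Phi4 (dens e) (X (z + e)).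
  by rewrite /above_strong /X /= !stateE zd0 add0r.
have E4 : above_strong (z, U) = Phi4 0 (X z) by rewrite /above_strong /X /= zd0.
have aux (p q x y : vec) : p - q - (x - y) = p - x - (q - y).
  by apply: stateP; rewrite !stateE; ring.
have le_max1 : Num.max `|dens e - 0| `|X (z + e) - X z| <= (1 + k2) * `|e|.
  rewrite ge_max subr0 mulrDl mul1r; apply/andP; split.
    by rewrite (le_trans ne) // lerDl mulr_ge0 // ltW.
  by rewrite (le_trans XX) // lerDr.
rewrite E1 E2 E3 E4 aux (le_trans H) //.
rewrite (le_trans (ler_wpM2l _ le_max1)) ?mulr_ge0 ?(ltW k10) //.
by rewrite le_eqVlt; apply/orP; left; apply/eqP; ring.
Qed.

Lemma reflection_inverse LG :
  strict_diff (fun x : R^o * vec => shock_state gamma x.1 x.2) (sigma10, Ub) LG ->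
  0 < velv (LG (1, 0)) -> pres (LG (1, 0)) < 0 ->
  exists B : vec -> vec, [/\ blin B,
    forall h, B (dens h *: r4 + (velv h *: r2 + pres h *: r3 + LG (velu h, 0))) = h,
    forall w, B w = 0 -> w = 0 & `|dens (B r1)| < 1].
Proof.
move=> sG v0 p0.
have [k [m [k0 m0 [v1 p1] [v4 p4]]]] :=
  eigvec_horizontal gamma_gt1 Um1_supersonic Um1_horizontal.
have [pU rU cU] := Um1_supersonic; have [c0 _ _] := supersonicP gamma_gt1 Um1_supersonic.
have u0 : velu Um1 != 0 by rewrite gt_eqF // (lt_trans c0).
have [B [Bb BL Bi B1]] := reflection_coefficient u0 (lt0r_neq0 rU) k0 m0 v0 p0 v1 p1 v4 p4.
exists B; split=> // h; rewrite -[RHS]BL; congr (B _).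
have -> : (velu h, 0 : vec) = velu h *: ((1, 0) : R^o * vec).
  by congr (_, _); rewrite /= ?scaler0 // [RHS]mulr1.
rewrite (blinZ sG.1) -/r2 -/r3 -/r4; move: (LG _) => g.
by apply: stateP; rewrite !stateE; ring.
Qed.

End Waves.

(** * Existence, uniqueness and the estimate for the Euler system *)

Unset Implicit Arguments.

Theorem proposition4p4 (R : realType) (gamma : R) (gamma_gt1 : 1 < gamma)
    (Phi1 Phi4 : R -> 'rV[R]_4 -> 'rV[R]_4)
    (Phi1_lax : lax_parametrization gamma 1 Phi1)
    (Phi4_lax : lax_parametrization gamma 4 Phi4)
    (Ub Um1 : 'rV[R]_4) (sigma10 : R)
    (Ub_supersonic : supersonic gamma Ub)
    (Um1_supersonic : supersonic gamma Um1)
    (Um1_horizontal : velv Um1 = 0)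
    (strong_shock : shock gamma 1 sigma10 Ub Um1) :
  exists M eta0 : R, 0 < M /\ 0 < eta0 /\
  forall eta : R, 0 < eta < eta0 ->
  exists2 eps : R, 0 < eps &
  forall (U1 U2 U3 : 'rV[R]_4)
         (sigma1 alpha2 alpha3 alpha4 beta1 beta2 beta3 : R),
    ball Ub eps U1 -> ball Um1 eps U2 -> ball Um1 eps U3 ->
    strong_waves gamma Phi1 Phi4 Um1 sigma10 eta U1 U2
      (sigma1, alpha2, alpha3, alpha4) ->
    weak_waves Phi1 Phi4 eta U2 U3 (beta1, beta2, beta3, 0) ->
  exists sigma1' delta2 delta3 delta4 : R,
    unique (strong_waves gamma Phi1 Phi4 Um1 sigma10 eta U1 U3)
      (sigma1', delta2, delta3, delta4) /\
  exists K1 K2 K3 K4 : R,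
    let Delta := `|alpha4| * (`|beta1| + `|beta2| + `|beta3|) in
    [/\ `|sigma1' - (sigma1 + K1 * beta1)| <= M * Delta,
        `|delta2 - (alpha2 + beta2 + K2 * beta1)| <= M * Delta,
        `|delta3 - (alpha3 + beta3 + K3 * beta1)| <= M * Delta
      & `|delta4 - (alpha4 + K4 * beta1)| <= M * Delta] /\
    `|K4| < 1 /\ `|K1| + `|K2| + `|K3| <= M.
Proof.
pose z0 : 'rV[R]_4 := vec4 sigma10 0 0 0.
have [LG [sG v0 p0]] := shock_state_diff gamma_gt1 Um1_horizontal strong_shock.
have sF := above_strong_diff gamma_gt1 Phi4_lax Um1_supersonic Um1_horizontal strong_shock sG.
have sP := above_weak_diff Phi1_lax Um1_supersonic Um1_horizontal.
have F0 := above_strong0 gamma_gt1 Phi4_lax Um1_supersonic strong_shock.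
have [B [Bb BL Bi B1]] := reflection_inverse gamma_gt1 Um1_supersonic Um1_horizontal sG v0 p0.
have z00 : dens z0 = 0 by rewrite /z0 stateE.
have [r [C [r0 C0 estimate]]] := interaction_estimate z00 F0 sF Bb BL Bi B1 sP
  (above_weak0 Phi1_lax Um1_supersonic)
  (above_weak_strong gamma_gt1 Phi1_lax Phi4_lax Um1_supersonic Um1_horizontal strong_shock)
  (above_weak_mixed Phi1_lax Um1_supersonic)
  (above_strong_mixed gamma_gt1 Phi4_lax Um1_supersonic Um1_horizontal strong_shock).
have [rI [CI [rI0 CI0 F_inj F_surj]]] := strict_inverse sF Bb BL Bi.
have [dS dS0 shock_near] := shock1_near gamma_gt1
  (strong_shock_state gamma_gt1 strong_shock).
have [_ [d1 d10 Phi10] _] := lax_strict_diff Phi1_lax Um1_supersonic.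
have [_ [d4 d40 Phi40] _] := lax_strict_diff Phi4_lax Um1_supersonic.
have [dP dP0 P_near] := strict_diff_near sP d40.
have Um1_state := Um1E gamma_gt1 strong_shock.
pose F := above_strong gamma Phi4; pose Psi := above_weak Phi1.
have PsiUm1 : Psi (0, Um1) = Um1.
  have [d d0 P0] := above_weak0 Phi1_lax Um1_supersonic.
  by apply: P0; rewrite subrr normr0.
(* Below [eta0], strengths lie in the range of the estimate and of injectivity, and a state within
   [eta] of [Um1] lies where [Phi1 0] is the identity. *)
pose eta0 := Num.min (Num.min r rI) (Num.min d1 dP).
have eta00 : 0 < eta0 by rewrite !lt_min r0 rI0 d10.
(* The factor 3 serves the sum of the three coefficients, each bounded by [C]. *)
exists (3 * C), eta0; split; first by rewrite mulr_gt0.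
split=> // eta /andP[eta_gt0]; rewrite !lt_min => /andP[/andP[er eI] /andP[e1 eP]].
have [dG dG0 G_near] := strict_diff_near sG eta_gt0.
(* The radius demanded of the fixed point: for speeds and lower states this close, the shock is
   admissible, its upper state is within [eta] of [Um1], and all strengths are below [eta]. *)
pose rho := Num.min eta (Num.min dG dS).
have rho0 : 0 < rho by rewrite !lt_min eta_gt0 dG0.
have rhoP (x : R) : x < rho -> [/\ x < eta, x < dG & x < dS].
  by rewrite !lt_min => /and3P[].
clearbody rho.
have [eF eF0 F_near] := F_surj _ rho0.
pose eps := Num.min eF (Num.min rho (Num.min (Num.min r rI) dP)).
have eps0 : 0 < eps by rewrite !lt_min eF0 rho0 r0 rI0.
have epsP (x : R) : x < eps -> [/\ x < eF, x < rho, x < r, x < rI & x < dP].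
  by rewrite !lt_min => /and4P[-> -> /andP[-> ->] ->].
clearbody eps; exists eps => //.
(* [strongE] turns the wave relation into the equation [V = F (z, U)]; [strongI] goes back, within
   the radius [rho], because there the shock has to be constructed. *)
have strongE U V s a2 a3 a4 :
    strong_waves gamma Phi1 Phi4 Um1 sigma10 eta U V (s, a2, a3, a4) ->
    `|vec4 s a2 a3 a4 - z0| < eta /\ V = F (vec4 s a2 a3 a4, U).
  move=> [s_eta a2_eta a3_eta a4_eta [G [[G_ball G_shock] _] ->]]; split.
    by apply: vec4_norm_lt; rewrite // /z0 !stateE ?subr0.
  move: G_ball; rewrite -ball_normE /ball_ /= distrC => G_ball.
  rewrite /Phi Phi10 ?(lt_trans G_ball) // (shock1_stateE gamma_gt1 G_shock).
  by rewrite /F /above_strong /= !stateE.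
have strongI U z : `|U - Ub| < rho -> `|z - z0| < rho ->
    strong_waves gamma Phi1 Phi4 Um1 sigma10 eta U (F (z, U)) (velu z, velv z, pres z, dens z).
  move=> /rhoP[Ueta UdG UdS] /rhoP[zeta zdG zdS].
  have [n1 n2 n3 n4] := coord_norm (z - z0).
  move: n1 n2 n3 n4; rewrite /z0 !stateE !subr0 -/z0 => n1 n2 n3 n4.
  have G_ball : `|shock_state gamma (velu z) U - Um1| < eta.
    have := G_near (velu z, U); rewrite /= Um1_state; apply.
    by rewrite prod_normE /= gt_max UdG (le_lt_trans n1).
  split; try exact: le_lt_trans zeta.
  exists (shock_state gamma (velu z) U); last first.
    by rewrite /Phi Phi10 // (lt_trans G_ball).
  split=> [|V [_ /(shock1_stateE gamma_gt1)->//]].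
  split; first by rewrite -ball_normE /ball_ /= distrC.
  by apply: shock_near => //; exact: le_lt_trans zdS.
move=> U1 U2 U3 sigma1 alpha2 alpha3 alpha4 beta1 beta2 beta3.
rewrite -!ball_normE /ball_ /= ![`|Um1 - _|]distrC ![`|Ub - _|]distrC.
move=> /epsP[U1F U1rho U1r U1I _] /epsP[_ _ _ _ U2P] /epsP[U3F _ _ _ _].
move=> /strongE[z_eta U2E] [b1_eta b2_eta b3_eta _ U3E].
set z := vec4 sigma1 alpha2 alpha3 alpha4 in z_eta U2E.
pose b : 'rV[R]_4 := vec4 beta1 beta2 beta3 0.
have b_eta : `|b| < eta by apply: vec4_norm_lt; rewrite // !stateE // normr0.
have {}U3E : U3 = Psi (b, U2).
  (* [Phi4 0] is the identity only near [Um1], so the state before the zero 4-wave has to be located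
     first. *)
  have PU : `|Psi (b, U2) - Um1| < d4.
    rewrite -[X in _ - X]PsiUm1; apply: P_near.
    by rewrite prod_normE /= gt_max subr0 U2P (lt_trans b_eta).
  have PE : Psi (b, U2) = contact beta2 beta3 (Phi1 beta1 U2).
    by rewrite /Psi /above_weak /b /= !vec4E.
  by rewrite U3E /Phi -/(contact _ _ _) -PE Phi40.
have U3F' : `|U3 - F (z0, Ub)| < eF by rewrite /F /z0 F0.
have [z' z'rho Fz'] := F_near U1 U3 U1F U3F'.
have [z'eta _ _] := rhoP _ z'rho.
exists (velu z'), (velv z'), (pres z'), (dens z'); split.
  split; first by rewrite -Fz'; exact: strongI.
  (* Competing strengths are below [eta], hence inside the radius where [F] is injective. *)
  move=> [[[s a2] a3] a4] /strongE[w_eta Fw].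
  suff -> : z' = vec4 s a2 a3 a4 by rewrite !stateE.
  apply/eqP; rewrite -subr_eq0 -normr_le0.
  rewrite (le_trans (F_inj _ _ U1 _ _ U1I)) ?(lt_trans _ eI) //.
  by rewrite Fz' Fw subrr normr0 mulr0.
have [|||||K [K_le K4 D_le]] := estimate U1 z b z' U1r.
- exact: lt_trans er.
- exact: lt_trans er.
- exact: lt_trans er.
- by rewrite stateE.
- by rewrite Fz' U3E U2E.
exists (velu K), (velv K), (pres K), (dens K).
have [k1 k2 k3 _] := coord_norm K.
have b_le : `|b| <= `|beta1| + `|beta2| + `|beta3|.
  apply: vec4_norm_le; rewrite ?addr_ge0 // !stateE ?normr0 ?addr_ge0 //.
  - by rewrite -addrA lerDl addr_ge0.
  - by rewrite addrAC lerDr addr_ge0.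
  - by rewrite lerDr addr_ge0.
have Delta_le : C * `|dens z| * `|b| <=
    3 * C * (`|alpha4| * (`|beta1| + `|beta2| + `|beta3|)).
  rewrite /z stateE mulrA ler_pM // ?mulr_ge0 ?(ltW C0) //.
  by rewrite ler_wpM2r // ler_peMl ?(ltW C0) // ler1n.
have [n1 n2 n3 n4] := coord_norm (z' - (z + vec4 0 (velv b) (pres b) 0 + velu b *: K)).
have {}D_le := le_trans D_le Delta_le.
have {n1} := le_trans n1 D_le; have {n2} := le_trans n2 D_le.
have {n3} := le_trans n3 D_le; have {n4} := le_trans n4 D_le.
rewrite /b /z !stateE !addr0 ![beta1 * _]mulrC => m4 m3 m2 m1.
split; first by [].
split=> //; rewrite mulr_natl !mulrS mulr0n addr0 addrA.
by rewrite !lerD // (le_trans _ K_le).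
Qed.
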